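(* Let $\epsilon,\mu>0$ be constants, $0<k_{min}<k_{max}$, $K:=(k_{min},k_{max})$, and for $k\in K$ let $\omega:=k/\sqrt{\epsilon\mu}$. For a source $\mathbf{J}\in(L^\infty(\mathbb{R}^3))^3$ with compact support let $$\mathbf{E}^\infty(\hat{\mathbf{x}},k;\mathbf{J})=i\omega\mu(\mathbb{I}-\hat{\mathbf{x}}\hat{\mathbf{x}}^{\rm T})\int_{\mathbb{R}^3}e^{-ik\hat{\mathbf{x}}\cdot\mathbf{y}}\mathbf{J}(\mathbf{y})\,d\mathbf{y}$$ be the electric far field pattern of the radiating solution of $\mathrm{curl}\,\mathrm{curl}\,\mathbf{E}-k^2\mathbf{E}=i\omega\mu\mathbf{J}$. Fix a point $\mathbf{z}_0\in\mathbb{R}^3$ and, for $\tau\in\mathbb{C}$ and $\mathbf{p}\in\mathbb{S}^2$, set $$\mathbf{E}^\infty_{\mathbf{z}_0}(\hat{\mathbf{x}},k;\mathbf{J},\tau,\mathbf{p}):=\mathbf{E}^\infty(\hat{\mathbf{x}},k;\mathbf{J})+ik\tau e^{-ik\hat{\mathbf{x}}\cdot\mathbf{z}_0}\,\hat{\mathbf{x}}\times\mathbf{p}$$ (the far field of the source $\mathbf{J}$ plus a magnetic dipole at $\mathbf{z}_0$ with strength $\tau$ and polarization $\mathbf{p}$). Let $\mathcal{T}=\{\tau_1,\tau_2,\tau_3\}\subset\mathbb{C}$ consist of three distinct numbers such that $\tau_2-\tau_1$ and $\tau_3-\tau_1$ are linearly independent (over $\mathbb{R}$). Fix $\hat{\mathbf{x}}_0\in\mathbb{S}^2$,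 choose $\mathbf{q}_0\in\mathbb{S}^2$ with $\hat{\mathbf{x}}_0\times\mathbf{q}_0\neq0$, and set $\mathbf{l}:=\hat{\mathbf{x}}_0\times\mathbf{q}_0/|\hat{\mathbf{x}}_0\times\mathbf{q}_0|$, $\mathbf{m}:=\hat{\mathbf{x}}_0\times\mathbf{l}$. For a source $\mathbf{J}$ with support $D$, define $$S(\hat{\mathbf{x}}_0;\mathbf{J}):=\{\mathbf{y}\in\mathbb{R}^3:\ \inf_{\mathbf{z}\in D}\mathbf{z}\cdot\hat{\mathbf{x}}_0\le\mathbf{y}\cdot\hat{\mathbf{x}}_0\le\sup_{\mathbf{z}\in D}\mathbf{z}\cdot\hat{\mathbf{x}}_0\},$$ $\Pi_\alpha:=\{\mathbf{y}\in\mathbb{R}^3:\ \mathbf{y}\cdot\hat{\mathbf{x}}_0+\alpha=0\}$ and $\hat{J}_{\mathbf{m}}(\alpha):=\int_{\Pi_\alpha}\mathbf{m}\cdot\mathbf{J}(\mathbf{y})\,ds(\mathbf{y})$ for $\alpha\in\mathbb{R}$. If the set $$\{\alpha\in\mathbb{R}:\ \Pi_\alpha\subset S(\hat{\mathbf{x}}_0;\mathbf{J}),\ \hat{J}_{\mathbf{m}}(\alpha)=0\}$$ has Lebesgue measure zero, then the strip $S(\hat{\mathbf{x}}_0;\mathbf{J})$ is uniquely determined by the phaseless data $|\mathbf{m}\cdot\mathbf{E}^\infty_{\mathbf{z}_0}(\hat{\mathbf{x}}_0,k;\mathbf{J},\tau,\mathbf{l})|$ for all $k\in K$, $\tau\in\mathcal{T}$.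 That is: if $\mathbf{J}_1,\mathbf{J}_2$ are two such sources, each satisfying the measure-zero condition, and $|\mathbf{m}\cdot\mathbf{E}^\infty_{\mathbf{z}_0}(\hat{\mathbf{x}}_0,k;\mathbf{J}_1,\tau,\mathbf{l})|=|\mathbf{m}\cdot\mathbf{E}^\infty_{\mathbf{z}_0}(\hat{\mathbf{x}}_0,k;\mathbf{J}_2,\tau,\mathbf{l})|$ for all $k\in K$ and $\tau\in\mathcal{T}$, then $S(\hat{\mathbf{x}}_0;\mathbf{J}_1)=S(\hat{\mathbf{x}}_0;\mathbf{J}_2)$.
   Context: $\mathbb{I}$ is the $3\times3$ identity matrix, $\mathbb{S}^2$ the unit sphere; $D$ denotes the support of $\mathbf{J}$; $ds$ is surface measure on $\Pi_\alpha$. Complex numbers are identified with points of $\mathbb{R}^2$ for the linear independence condition on $\tau_2-\tau_1,\tau_3-\tau_1$. *)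

(* Defs.v *)
From HB Require Import structures.
From mathcomp Require Import all_boot all_order all_algebra.
From mathcomp Require Import all_classical all_reals all_analysis.
From mathcomp Require Import complex.
Set Implicit Arguments. Unset Strict Implicit. Unset Printing Implicit Defensive.
Import Order.TTheory GRing.Theory Num.Theory.
Import numFieldNormedType.Exports.
Local Open Scope classical_set_scope.
Local Open Scope ring_scope.
Local Open Scope complex_scope.

Section Defs.
Variable R : realType.
Local Notation C := (complex R).

Local Notation R3 := (R * R * R)%type.
Local Notation C3 := (C * C * C)%type.

Definition mkR3 (a b c : R) : R3 := (a, b, c).
Definition addR3 (x y : R3) : R3 := (x.1.1 + y.1.1, x.1.2 + y.1.2, x.2 + y.2).
Definition sclR3 (a : R) (x : R3) : R3 := (a * x.1.1, a * x.1.2, a * x.2).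
Definition dotR3 (x y : R3) : R := x.1.1 * y.1.1 + x.1.2 * y.1.2 + x.2 * y.2.
Definition normR3 (x : R3) : R := Num.sqrt (dotR3 x x).
Definition crossR3 (x y : R3) : R3 :=
  (x.1.2 * y.2 - x.2 * y.1.2, x.2 * y.1.1 - x.1.1 * y.2, x.1.1 * y.1.2 - x.1.2 * y.1.1).
Definition sphere2 : set R3 := [set x | normR3 x = 1].

Definition dotRC3 (a : R3) (v : C3) : C :=
  (a.1.1)%:C * v.1.1 + (a.1.2)%:C * v.1.2 + (a.2)%:C * v.2.
Definition sclCR3 (c : C) (a : R3) : C3 := (c * (a.1.1)%:C, c * (a.1.2)%:C, c * (a.2)%:C).
Definition sclC3 (c : C) (v : C3) : C3 := (c * v.1.1, c * v.1.2, c * v.2).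
Definition addC3 (v w : C3) : C3 := (v.1.1 + w.1.1, v.1.2 + w.1.2, v.2 + w.2).
Definition tproj (x : R3) (v : C3) : C3 := addC3 v (sclCR3 (- dotRC3 x v) x).

Definition expi (t : R) : C := Complex (cos t) (sin t).

Definition leb2 := ((@lebesgue_measure R) \x (@lebesgue_measure R))%E.
Definition leb3 := (((@lebesgue_measure R) \x (@lebesgue_measure R)) \x (@lebesgue_measure R))%E.

Definition cint3 (f : R3 -> C) : C :=
  Complex (Rintegral leb3 setT (fun y => complex.Re (f y))) (Rintegral leb3 setT (fun y => complex.Im (f y))).
Definition cint2 (f : R * R -> C) : C :=
  Complex (Rintegral leb2 setT (fun y => complex.Re (f y))) (Rintegral leb2 setT (fun y => complex.Im (f y))).
Definition cint3v (F : R3 -> C3) : C3 :=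
  (cint3 (fun y => (F y).1.1), cint3 (fun y => (F y).1.2), cint3 (fun y => (F y).2)).

Definition Linfty3 (J : R3 -> C3) : Prop :=
  [/\ measurable_fun setT (fun y => complex.Re (J y).1.1) /\ measurable_fun setT (fun y => complex.Im (J y).1.1),
      measurable_fun setT (fun y => complex.Re (J y).1.2) /\ measurable_fun setT (fun y => complex.Im (J y).1.2),
      measurable_fun setT (fun y => complex.Re (J y).2) /\ measurable_fun setT (fun y => complex.Im (J y).2) &
      (exists M : R, {ae leb3, forall y,
        [/\ `|(J y).1.1| <= M%:C, `|(J y).1.2| <= M%:C & `|(J y).2| <= M%:C]})].

(* (essential) support of J: complement of the largest open set on which J = 0 a.e. *)
Definition esupp (J : R3 -> C3) : set R3 :=
  [set x : R3 | forall U : set R3, open U -> U x -> ~ leb3.-negligible (U `&` [set y | J y != 0])].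

Definition Einf (eps mu k : R) (xh : R3) (J : R3 -> C3) : C3 :=
  let omega := k / Num.sqrt (eps * mu) in
  sclC3 ('i * (omega * mu)%:C)
    (tproj xh (cint3v (fun y => sclC3 (expi (- (k * dotR3 xh y))) (J y)))).

Definition Einf_z0 (eps mu k : R) (z0 xh : R3) (J : R3 -> C3) (tau : C) (p : R3) : C3 :=
  addC3 (Einf eps mu k xh J)
        (sclCR3 ('i * k%:C * tau * expi (- (k * dotR3 xh z0))) (crossR3 xh p)).

Definition strip (xh0 : R3) (J : R3 -> C3) : set R3 :=
  [set y | (ereal_inf [set (dotR3 z xh0)%:E | z in esupp J] <= (dotR3 y xh0)%:E)%E /\
           ((dotR3 y xh0)%:E <= ereal_sup [set (dotR3 z xh0)%:E | z in esupp J])%E].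

Definition plane (xh0 : R3) (alpha : R) : set R3 := [set y | dotR3 y xh0 + alpha = 0].

(* \hat J_m(alpha) = int_{Pi_alpha} m . J ds, the plane being parametrized isometrically by
   (s, t) |-> -alpha xh0 + s l + t m  (xh0, l, m orthonormal) *)
Definition Jhat (xh0 l m : R3) (J : R3 -> C3) (alpha : R) : C :=
  cint2 (fun st => dotRC3 m (J (addR3 (sclR3 (- alpha) xh0)
                                  (addR3 (sclR3 st.1 l) (sclR3 st.2 m))))).

Definition jhat_cond (xh0 l m : R3) (J : R3 -> C3) : Prop :=
  (@lebesgue_measure R).-negligible
    [set alpha | plane xh0 alpha `<=` strip xh0 J /\ Jhat xh0 l m J alpha = 0].

End Defs.

(* Main.v *)
(* Write W(a) for the integral of m . J over the plane Pi_a. In the orthonormal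
   coordinates (l, m, -xh0), Fubini turns m . E^infty(xh0, k; J) into the
   one-dimensional Fourier transform int e^{ika} W(a) da, up to a nonzero
   factor. The dipole adds c tau with c != 0, and a complex number A is
   determined by |A + c tau| for three noncollinear tau, so the phaseless data
   determine this transform for k in K. For two sources with the same data the
   transform of W1 - W2, which has compact support, vanishes on K together with
   all its derivatives; hence all moments of e^{ika} (W1 - W2) vanish, and
   W1 = W2 almost everywhere.
   Off the depth range of J1 we get W2 = W1 = 0, so by the nondegeneracy of J2
   the part of its depth range lying there is null, and J2 vanishes there. By
   symmetry the two strips coincide. *)
Require Import Defs.
From HB Require Import structures.
From mathcomp Require Import all_boot all_order all_algebra.
From mathcomp Require Import all_classical all_reals all_analysis.
From mathcomp Require Import complex measurable_realfun ring lra.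
Set Implicit Arguments. Unset Strict Implicit. Unset Printing Implicit Defensive.
Import Order.TTheory GRing.Theory Num.Theory.
Import numFieldNormedType.Exports.
Local Open Scope classical_set_scope.
Local Open Scope ring_scope.
Local Open Scope complex_scope.

(** [K] is a real interval and no analytic continuation is used: differentiation under the integral
    keeps every moment equal to 0 on all of [K], after which a single frequency suffices. Zero
    moments are turned into zero values by polynomials that converge boundedly to the indicator of a
    half-line, off one point; the primitive of the function is then constant, and Lebesgue
    differentiation finishes. The second obstacle is geometric: [leb3] is an iterated product
    measure tied to the standard axes, while the planes are tilted. Its invariance under the change
    of frame is derived from translations and reflections of the line, by writing a matrix of
    determinant 1 as a product of shears, each of which acts by translations on the fibres. Plane
    integrals are controlled only for almost every depth. This is enough because [esupp] ignores
    null sets: a null set of depths pulls back to a null set of points, and the depths outside the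
    range of a source form an open set, so no point of the other support can lie over them. *)

Definition measure_preserving {d} {T : measurableType d} {R : realType}
    (mu : set T -> \bar R) (g : T -> T) : Prop :=
  measurable_fun setT g /\ forall A, measurable A -> mu (g @^-1` A) = mu A.

Lemma measure_preserving_comp {d} {T : measurableType d} {R : realType}
    (mu : set T -> \bar R) (f g : T -> T) :
  measure_preserving mu f -> measure_preserving mu g ->
  measure_preserving mu (f \o g).
Proof.
move=> [mf fP] [mg gP]; split; first exact: measurableT_comp.
move=> A mA; rewrite comp_preimage gP ?fP//.
by rewrite -[X in measurable X]setTI; exact: mf.
Qed.

(** [\x] integrates the [m2]-measure of sections over the first factor, and a section of the
    preimage is the preimage of the section under [g x]. The shears below come from this lemma, its
    mirror image and translation invariance. *)
Lemma measure_preserving_fibers2 {d1 d2} {T1 : measurableType d1}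
    {T2 : measurableType d2} {R : realType}
    (m1 : {sigma_finite_measure set T1 -> \bar R})
    (m2 : {sigma_finite_measure set T2 -> \bar R}) (g : T1 -> T2 -> T2) :
  measurable_fun setT (fun z : T1 * T2 => g z.1 z.2) ->
  (forall x, measure_preserving m2 (g x)) ->
  measure_preserving (m1 \x m2)%E (fun z : T1 * T2 => (z.1, g z.1 z.2)).
Proof.
move=> mg gP; split; first exact: (measurable_fun_pair measurable_fst mg).
move=> A mA; rewrite /product_measure1; apply: eq_integral => x _ /=.
rewrite -((gP x).2 (xsection A x)); last exact: measurable_xsection.
by congr (m2 _); apply/seteqP; split => y /=; rewrite /xsection/= !inE.
Qed.

(** The product measure is built by slicing along the first factor. Slicing along the second gives a
    measure with the same values on rectangles, so uniqueness identifies the two. *)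
Lemma product_measure1_swapE {d1 d2} {T1 : measurableType d1}
    {T2 : measurableType d2} {R : realType}
    (m1 : {sigma_finite_measure set T1 -> \bar R})
    (m2 : {sigma_finite_measure set T2 -> \bar R}) (A : set (T1 * T2)) :
  measurable A -> ((m1 \x m2) A = \int[m2]_y (m1 (ysection A y)))%E.
Proof.
move=> mA; transitivity ((m1 \x^ m2)%E A) => //.
by apply: product_measure_unique => //= *; rewrite product_measure2E.
Qed.

Lemma measure_preserving_fibers1 {d1 d2} {T1 : measurableType d1}
    {T2 : measurableType d2} {R : realType}
    (m1 : {sigma_finite_measure set T1 -> \bar R})
    (m2 : {sigma_finite_measure set T2 -> \bar R}) (g : T2 -> T1 -> T1) :
  measurable_fun setT (fun z : T1 * T2 => g z.2 z.1) ->
  (forall y, measure_preserving m1 (g y)) ->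
  measure_preserving (m1 \x m2)%E (fun z : T1 * T2 => (g z.2 z.1, z.2)).
Proof.
move=> mg gP.
have mG : measurable_fun setT (fun z : T1 * T2 => (g z.2 z.1, z.2)).
  exact: (measurable_fun_pair mg measurable_snd).
split=> // A mA; rewrite !product_measure1_swapE//; last first.
  by rewrite -[X in measurable X]setTI; exact: mG.
apply: eq_integral => y _ /=.
rewrite -((gP y).2 (ysection A y)); last exact: measurable_ysection.
by congr (m1 _); apply/seteqP; split => x /=; rewrite /ysection/= !inE.
Qed.

(** The pushforward has the right value on every []a, b]], and these values determine Lebesgue
    measure. *)
Lemma lebesgue_measure_shift {R : realType} (c : R) :
  measure_preserving (@lebesgue_measure R) (fun x => x + c).
Proof.
have mg : measurable_fun [set: measurableTypeR R]
    (fun x => x + c : measurableTypeR R) by exact: measurable_funD.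
split=> // A mA.
pose mix := isMeasurableFun.Build _ _ _ _ _ mg.
pose g : {mfun measurableTypeR R >-> measurableTypeR R} :=
  HB.pack (fun x : R => x + c) mix.
transitivity (pushforward (@lebesgue_measure R) g A) => //; apply/esym.
apply: lebesgue_measure_unique => //.
move=> _ [[a b] _ <-] /=; rewrite /pushforward/=.
have -> : (fun x : R => x + c) @^-1` `]a, b] = `]a - c, b - c]%classic.
  by apply/seteqP; split=> x /=; rewrite !in_itv/= ltrBlDr lerBrDr.
rewrite !lebesgue_measure_itv/= !lte_fin ltrD2r; case: ifPn => // _.
by rewrite -!EFinD; congr EFin; ring.
Qed.

Lemma lebesgue_measure_opp {R : realType} :
  measure_preserving (@lebesgue_measure R) (fun x => - x).
Proof.
have mg : measurable_fun [set: measurableTypeR R]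
    (fun x => - x : measurableTypeR R) by exact: oppr_measurable.
split=> // A mA.
pose mix := isMeasurableFun.Build _ _ _ _ _ mg.
pose g : {mfun measurableTypeR R >-> measurableTypeR R} :=
  HB.pack (fun x : R => - x) mix.
transitivity (pushforward (@lebesgue_measure R) g A) => //; apply/esym.
apply: lebesgue_measure_unique => //.
move=> _ [[a b] _ <-] /=; rewrite /pushforward/=.
have -> : (fun x : R => - x) @^-1` `]a, b] = `[- b, - a[%classic.
  by apply/seteqP; split=> x /=; rewrite !in_itv/= lerNl ltrNr andbC.
rewrite !lebesgue_measure_itv/= !lte_fin ltrN2; case: ifPn => // _.
by rewrite -!EFinD; congr EFin; ring.
Qed.

Section Leb2Instances.
Variable R : realType.

(* The library's sigma-finite instance on [\x] only covers subprobabilities. *)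
HB.instance Definition _ := Measure.copy (@leb2 R)
  ((@lebesgue_measure R) \x (@lebesgue_measure R))%E.

Lemma sigma_finite_leb2 : sigma_finite setT (@leb2 R).
Proof.
have /sigma_finiteP[F [TF ndF Foo]] := sigma_finiteT (@lebesgue_measure R).
exists (fun n => F n `*` F n).
  rewrite -setXTT TF predeqE => -[x y]; split.
    move=> [/= [n _ Fnx] [k _ Gky]]; exists (maxn n k) => //; split.
    - by move: x Fnx; exact/subsetPset/ndF/leq_maxl.
    - by move: y Gky; exact/subsetPset/ndF/leq_maxr.
  by move=> [n _ []/= ? ?]; split; exists n.
move=> k; have [? ?] := Foo k; split; first exact: measurableX.
by rewrite /leb2 product_measure1E// lte_mul_pinfty// ge0_fin_numE.
Qed.

HB.instance Definition _ :=
  Measure_isSigmaFinite.Build _ _ _ (@leb2 R) sigma_finite_leb2.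

HB.instance Definition _ := Measure.copy (@leb3 R)
  (@leb2 R \x (@lebesgue_measure R))%E.

Lemma ae_leb3_filter : Filter (nbhs (almost_everywhere (@leb3 R))).
Proof. exact: (ae_filter_ringOfSetsType (@leb3 R)). Qed.

Lemma ae_lebesgue_filter : Filter (nbhs (almost_everywhere (@lebesgue_measure R))).
Proof. exact: (ae_filter_ringOfSetsType (@lebesgue_measure R)). Qed.

End Leb2Instances.
#[export] Existing Instance ae_leb3_filter.
#[export] Existing Instance ae_lebesgue_filter.

(** * Invariance of [leb3] under linear maps of determinant 1 or -1 *)

Section Frames.
Variable R : realType.
Local Notation R3 := (R * R * R)%type.
Local Notation leb := (@lebesgue_measure R).
Implicit Types (u v w z : R3) (c : R).

Lemma leb2_shift1 c :
  measure_preserving (@leb2 R) (fun z : R * R => (z.1 + c, z.2)).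
Proof.
apply: (@measure_preserving_fibers1 _ _ _ _ R leb leb
  (fun (_ x : R) => x + c)).
  by apply: measurable_funD => //; exact: measurable_fst.
by move=> _; exact: lebesgue_measure_shift.
Qed.

Lemma leb2_shift2 c :
  measure_preserving (@leb2 R) (fun z : R * R => (z.1, z.2 + c)).
Proof.
apply: (@measure_preserving_fibers2 _ _ _ _ R leb leb
  (fun (_ x : R) => x + c)).
  by apply: measurable_funD => //; exact: measurable_snd.
by move=> _; exact: lebesgue_measure_shift.
Qed.

Lemma leb2_shear12 c :
  measure_preserving (@leb2 R) (fun z : R * R => (z.1, z.2 + c * z.1)).
Proof.
apply: (@measure_preserving_fibers2 _ _ _ _ R leb leb
  (fun (t x : R) => x + c * t)).
  apply: measurable_funD; first exact: measurable_snd.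
  by apply: measurable_funM => //; exact: measurable_fst.
by move=> t; exact: lebesgue_measure_shift.
Qed.

Lemma leb2_shear21 c :
  measure_preserving (@leb2 R) (fun z : R * R => (z.1 + c * z.2, z.2)).
Proof.
apply: (@measure_preserving_fibers1 _ _ _ _ R leb leb
  (fun (t x : R) => x + c * t)).
  apply: measurable_funD; first exact: measurable_fst.
  by apply: measurable_funM => //; exact: measurable_snd.
by move=> t; exact: lebesgue_measure_shift.
Qed.

(** The matrix with columns [u], [v], [w]. Fixing the third coordinate parametrizes an affine plane
    as in [Jhat], in accordance with the splitting of [leb3] into [leb2] and the line. *)
Definition R3_basis_map u v w z : R3 :=
  addR3 (sclR3 z.2 w) (addR3 (sclR3 z.1.1 u) (sclR3 z.1.2 v)).

Lemma measurable_coord1 : measurable_fun setT (fun z : R3 => z.1.1).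
Proof. exact: (measurableT_comp measurable_fst measurable_fst). Qed.

Lemma measurable_coord2 : measurable_fun setT (fun z : R3 => z.1.2).
Proof. exact: (measurableT_comp measurable_snd measurable_fst). Qed.

Lemma measurable_coord3 : measurable_fun setT (fun z : R3 => z.2).
Proof. exact: measurable_snd. Qed.

Lemma measure_preserving_leb3_fiber1 (g : R -> R * R -> R * R) :
  measurable_fun setT (fun z : R3 => g z.2 z.1) ->
  (forall a, measure_preserving (@leb2 R) (g a)) ->
  measure_preserving (@leb3 R) (fun z : R3 => (g z.2 z.1, z.2)).
Proof.
move=> mg gP.
exact: (@measure_preserving_fibers1 _ _ _ _ R (@leb2 R) leb g).
Qed.

Lemma leb3_shear3 c1 c2 : measure_preserving (@leb3 R)
  (fun z : R3 => (z.1, z.2 + (c1 * z.1.1 + c2 * z.1.2))).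
Proof.
apply: (@measure_preserving_fibers2 _ _ _ _ R (@leb2 R) leb
  (fun (t : R * R) (x : R) => x + (c1 * t.1 + c2 * t.2))).
  apply: measurable_funD; first exact: measurable_snd.
  apply: measurable_funD; apply: measurable_funM => //.
    exact: measurable_coord1.
  exact: measurable_coord2.
by move=> t; exact: lebesgue_measure_shift.
Qed.

Lemma leb3_shear12 c :
  measure_preserving (@leb3 R) (fun z : R3 => (z.1.1, z.1.2 + c * z.1.1, z.2)).
Proof.
apply: (@measure_preserving_leb3_fiber1 (fun _ t => (t.1, t.2 + c * t.1))).
  apply: measurable_fun_pair; first exact: measurable_coord1.
  apply: measurable_funD; first exact: measurable_coord2.
  by apply: measurable_funM => //; exact: measurable_coord1.
by move=> _; exact: leb2_shear12.
Qed.

Lemma leb3_shear21 c :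
  measure_preserving (@leb3 R) (fun z : R3 => (z.1.1 + c * z.1.2, z.1.2, z.2)).
Proof.
apply: (@measure_preserving_leb3_fiber1 (fun _ t => (t.1 + c * t.2, t.2))).
  apply: measurable_fun_pair; last exact: measurable_coord2.
  apply: measurable_funD; first exact: measurable_coord1.
  by apply: measurable_funM => //; exact: measurable_coord2.
by move=> _; exact: leb2_shear21.
Qed.

Lemma leb3_shear31 c :
  measure_preserving (@leb3 R) (fun z : R3 => (z.1.1 + c * z.2, z.1.2, z.2)).
Proof.
apply: (@measure_preserving_leb3_fiber1 (fun a t => (t.1 + c * a, t.2))).
  apply: measurable_fun_pair; last exact: measurable_coord2.
  apply: measurable_funD; first exact: measurable_coord1.
  by apply: measurable_funM => //; exact: measurable_coord3.
by move=> a; exact: leb2_shift1.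
Qed.

Lemma leb3_shear32 c :
  measure_preserving (@leb3 R) (fun z : R3 => (z.1.1, z.1.2 + c * z.2, z.2)).
Proof.
apply: (@measure_preserving_leb3_fiber1 (fun a t => (t.1, t.2 + c * a))).
  apply: measurable_fun_pair; first exact: measurable_coord1.
  apply: measurable_funD; first exact: measurable_coord2.
  by apply: measurable_funM => //; exact: measurable_coord3.
by move=> a; exact: leb2_shift2.
Qed.

Local Notation P u v w := (measure_preserving (@leb3 R) (R3_basis_map u v w)).
Local Notation "u +_ c v" := (addR3 u (sclR3 c v))
  (at level 50, c at level 9, v at level 9).

Ltac R3_ext := apply/funext => -[[? ?] ?];
  rewrite /R3_basis_map /addR3 /sclR3 /=; congr (_, _, _); ring.

(** Composing on the right with a shear is a column operation, and the coefficient [- c] undoes the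
    addition. This lemma and the next five allow a goal to be reduced column by column. *)
Lemma basis_map_addl u v w c : P (u +_ c v) v w -> P u v w.
Proof.
move=> h; have := measure_preserving_comp h (leb3_shear12 (- c)).
by congr measure_preserving; R3_ext.
Qed.

Lemma basis_map_addlr u v w c : P (u +_ c w) v w -> P u v w.
Proof.
move=> h; have := measure_preserving_comp h (leb3_shear3 (- c) 0).
by congr measure_preserving; R3_ext.
Qed.

Lemma basis_map_addml u v w c : P u (v +_ c u) w -> P u v w.
Proof.
move=> h; have := measure_preserving_comp h (leb3_shear21 (- c)).
by congr measure_preserving; R3_ext.
Qed.

Lemma basis_map_addmr u v w c : P u (v +_ c w) w -> P u v w.
Proof.
move=> h; have := measure_preserving_comp h (leb3_shear3 0 (- c)).
by congr measure_preserving; R3_ext.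
Qed.

Lemma basis_map_addrl u v w c : P u v (w +_ c u) -> P u v w.
Proof.
move=> h; have := measure_preserving_comp h (leb3_shear31 (- c)).
by congr measure_preserving; R3_ext.
Qed.

Lemma basis_map_addrm u v w c : P u v (w +_ c v) -> P u v w.
Proof.
move=> h; have := measure_preserving_comp h (leb3_shear32 (- c)).
by congr measure_preserving; R3_ext.
Qed.

Lemma basis_map_id : P (1, 0, 0) (0, 1, 0) (0, 0, 1).
Proof.
have -> : R3_basis_map (1, 0, 0) (0, 1, 0) (0, 0, 1) = id by R3_ext.
by split => //; exact: measurable_id.
Qed.

Definition detR3 u v w : R := dotR3 (crossR3 u v) w.

Lemma basis_map_unitriangular a b c : P (1, a, b) (0, 1, c) (0, 0, 1).
Proof.
apply: (@basis_map_addmr _ _ _ (- c)); rewrite /addR3 /sclR3 /=.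
apply: (@basis_map_addlr _ _ _ (- b)); rewrite /addR3 /sclR3 /=.
apply: (@basis_map_addl _ _ _ (- a)); rewrite /addR3 /sclR3 /=.
by have := basis_map_id; congr (P (_, _, _) (_, _, _) _); ring.
Qed.

Lemma basis_map_det2 a b (v2 v3 w2 w3 : R) : v2 * w3 - v3 * w2 = 1 ->
  P (1, a, b) (0, v2, v3) (0, w2, w3).
Proof.
have h x2 x3 y2 y3 : y2 != 0 -> x2 * y3 - x3 * y2 = 1 ->
    P (1, a, b) (0, x2, x3) (0, y2, y3).
  move=> y0 d1.
  (* The coefficient turns the second entry of the middle column into 1; clearing [y2] with it
     leaves the determinant, hence 1, in the corner. Pivots are made by adding columns, never by
     scaling, which would change volume. *)
  apply: (@basis_map_addmr _ _ _ ((1 - x2) / y2)); rewrite /addR3 /sclR3 /=.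
  apply: (@basis_map_addrm _ _ _ (- y2)); rewrite /addR3 /sclR3 /=.
  have := basis_map_unitriangular a b (x3 + (1 - x2) / y2 * y3).
  congr (P _ (_, _, _) (_, _, _)); try by field.
  by rewrite -[LHS]d1; field.
have [w20|w20] := eqVneq w2 0; last exact: h.
rewrite w20 mulr0 subr0 => d1.
(* With [w2 = 0] the determinant forces [v2] to be nonzero, so adding the middle column creates the
   entry that [h] divides by. *)
apply: (@basis_map_addrm _ _ _ 1); rewrite /addR3 /sclR3 /= !mul1r !add0r.
apply: h; first by apply: contraTneq (oner_neq0 R) => v20; rewrite -d1 v20 mul0r eqxx.
by rewrite -d1; ring.
Qed.

Lemma basis_map_lead1 a b v w : detR3 (1, a, b) v w = 1 -> P (1, a, b) v w.
Proof.
case: v w => [[v1 v2] v3] [[w1 w2] w3]; rewrite /detR3 /dotR3 /crossR3 /= => d1.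
apply: (@basis_map_addml _ _ _ (- v1)); rewrite /addR3 /sclR3 /= mulr1 subrr.
apply: (@basis_map_addrl _ _ _ (- w1)); rewrite /addR3 /sclR3 /= mulr1 subrr.
by apply: basis_map_det2; rewrite -d1; ring.
Qed.

(* Gaussian elimination by column operations, each of which is a shear. *)
Lemma basis_map_det1 u v w : detR3 u v w = 1 -> P u v w.
Proof.
have h x y z : y.1.1 != 0 -> detR3 x y z = 1 -> P x y z.
  case: x y z => [[x1 x2] x3] [[y1 y2] y3] [[z1 z2] z3] /= y10 d1.
  apply: (@basis_map_addl _ _ _ ((1 - x1) / y1)); rewrite /addR3 /sclR3 /=.
  have -> : x1 + (1 - x1) / y1 * y1 = 1 by field.
  apply: basis_map_lead1; rewrite -d1 /detR3 /dotR3 /crossR3 /=.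
  by field.
have h' x y z : z.1.1 != 0 -> detR3 x y z = 1 -> P x y z.
  move=> z10 d1; have [y10|] := eqVneq y.1.1 0; last by move=> y10; exact: h.
  apply: (@basis_map_addmr _ _ _ 1); apply: h.
    by rewrite /= y10 add0r mul1r.
  by rewrite -d1 /detR3 /dotR3 /crossR3 /addR3 /sclR3 /=; ring.
move=> d1; have [w10|] := eqVneq w.1.1 0; last by move=> w10; exact: h'.
have [v10|] := eqVneq v.1.1 0; last by move=> v10; exact: h.
(* Only [u] can still have a nonzero first entry, and it must have one or the determinant would be
   0; adding [u] to [v] puts that entry where [h] needs it. *)
apply: (@basis_map_addml _ _ _ 1); apply: h.
  rewrite /= v10 add0r mul1r; apply: contraTneq (oner_neq0 R) => u10.
  by rewrite -d1 /detR3 /dotR3 /crossR3 /= u10 v10 w10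
    !(mul0r, mulr0, subr0, addr0) eqxx.
by rewrite -d1 /detR3 /dotR3 /crossR3 /addR3 /sclR3 /=; ring.
Qed.

(** Shears only reach determinant 1, so the last axis is reflected. This is the case needed later,
    because the frame [l], [m], [- x0] reverses orientation. *)
Lemma basis_map_detN1 u v w : detR3 u v w = - 1 -> P u v w.
Proof.
move=> d1; have h : P u v (sclR3 (- 1) w).
  apply: basis_map_det1; transitivity (- detR3 u v w); last by rewrite d1 opprK.
  by rewrite /detR3 /dotR3 /crossR3 /sclR3 /=; ring.
have hN : measure_preserving (@leb3 R) (fun z : R3 => (z.1, - z.2)).
  apply: (@measure_preserving_fibers2 _ _ _ _ R (@leb2 R) leb (fun _ t => - t)).
    by apply: (measurable_funN (f := fun z : R3 => z.2)); exact: measurable_coord3.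
  by move=> _; exact: lebesgue_measure_opp.
have := measure_preserving_comp h hN.
by congr measure_preserving; R3_ext.
Qed.

End Frames.

(** * Polynomials approximating a jump at 1/2 *)

Section StepPolynomials.
Variable R : realType.
Implicit Types (t s x : R) (n N : nat).

Lemma bernoulli_ge t N : 0 <= t <= 1 -> 1 - N%:R * t <= (1 - t) ^+ N.
Proof.
move=> /andP[t0 t1]; elim: N => [|N IH]; first by rewrite expr0 mul0r subr0.
rewrite exprS -natr1.
have := ler_wpM2l (_ : 0 <= 1 - t) IH; rewrite subr_ge0 => /(_ t1).
have : 0 <= N%:R * t * t by rewrite !mulr_ge0.
by nra.
Qed.

(** The induction rests on (1 - t)(1 + (N + 1)t) <= 1 + Nt. With [bernoulli_ge] this traps (1 - t)^N
    between two expressions in the product Nt alone. *)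
Lemma bernoulli_le t N : 0 <= t <= 1 -> (1 - t) ^+ N * (1 + N%:R * t) <= 1.
Proof.
move=> /andP[t0 t1]; elim: N => [|N IH]; first by rewrite expr0 mul0r addr0 mulr1.
apply: le_trans IH; rewrite exprS -natr1 [(1 - t) * _]mulrC -mulrA.
apply: ler_wpM2l; first by rewrite exprn_ge0// subr_ge0.
have : 0 <= N%:R * t * t by rewrite !mulr_ge0.
by nra.
Qed.

(** Polynomials of the kind found in elementary proofs of the Stone-Weierstrass theorem. The
    exponents are matched: for t = s^n and N = 2^n, the product Nt in the Bernoulli bounds is
    (2s)^n, which for s in [0, 1] tends to 0 below 1/2 and to infinity above it. *)
Definition step_fun n s : R := (1 - s ^+ n) ^+ (2 ^ n).

Lemma step_fun_itv n s : 0 <= s <= 1 -> 0 <= step_fun n s <= 1.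
Proof.
move=> /andP[s0 s1]; have sn1 : s ^+ n <= 1 by rewrite exprn_ile1.
have sn0 : 0 <= s ^+ n by rewrite exprn_ge0.
by rewrite /step_fun exprn_ge0/= ?exprn_ile1 ?subr_ge0// lerBlDr lerDl.
Qed.

Lemma step_fun_cvg1 s : 0 <= s < 2^-1 -> step_fun n s @[n --> \oo] --> (1 : R).
Proof.
move=> /andP[s0 s1].
have s01 : 0 <= s <= 1 by apply/andP; split=> //; lra.
apply: (@squeeze_cvgr _ _ _ _ (fun n => 1 - (2 * s) ^+ n) (cst 1)).
- near=> n; rewrite (andP (step_fun_itv n s01)).2 andbT.
  have : 0 <= s ^+ n <= 1.
    by rewrite exprn_ge0//= exprn_ile1// (andP s01).2.
  by move=> /(@bernoulli_ge _ (2 ^ n)); rewrite natrX -exprMn.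
- rewrite -[X in _ --> X]subr0; apply: cvgB; first exact: cvg_cst.
  by apply: cvg_expr; rewrite ger0_norm; lra.
- exact: cvg_cst.
Unshelve. all: by end_near. Qed.

Lemma step_fun_cvg0 s : 2^-1 < s <= 1 -> step_fun n s @[n --> \oo] --> (0 : R).
Proof.
move=> /andP[s0 s1].
have s01 : 0 <= s <= 1 by apply/andP; split=> //; lra.
have s2 : 1 < 2 * s by lra.
apply: (@squeeze_cvgr _ _ _ _ (cst 0) (fun n => (2 * s)^-1 ^+ n)).
- near=> n; rewrite (andP (step_fun_itv n s01)).1 /=.
  have : 0 <= s ^+ n <= 1.
    by rewrite exprn_ge0 ?(andP s01).1//= exprn_ile1// (andP s01).1.
  move=> /(@bernoulli_le _ (2 ^ n)); rewrite natrX -exprMn => hb.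
  have h : 0 < (2 * s) ^+ n by rewrite exprn_gt0//; lra.
  rewrite exprVn -[X in _ <= X]mul1r ler_pdivlMr//; apply: le_trans hb.
  apply: ler_wpM2l; first by rewrite (andP (step_fun_itv n s01)).1.
  by rewrite lerDr.
- exact: cvg_cst.
- apply: cvg_expr; by rewrite ger0_norm ?invf_lt1 ?invr_ge0//; lra.
Unshelve. all: by end_near. Qed.

End StepPolynomials.

Lemma integrable_bounded_mul {d} {T : measurableType d} {R : realType}
    (mu : {measure set T -> \bar R}) (D : set T) (u g : T -> R) (M : R) :
  measurable D -> mu.-integrable D (EFin \o u) -> measurable_fun D g ->
  (forall x, D x -> `|g x| <= M) ->
  mu.-integrable D (EFin \o (fun x => g x * u x)).
Proof.
move=> mD iu mg gM.
have mu' : measurable_fun D u.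
  by apply/measurable_EFinP; exact: (measurable_int mu iu).
apply: (@le_integrable _ _ _ mu _ _ _ (fun x => M%:E * (EFin \o u) x)%E) => //.
- by apply/measurable_EFinP; exact: measurable_funM.
- move=> x Dx /=; rewrite lee_fin !normrM.
  by apply: ler_wpM2r => //; apply: (le_trans (gM _ Dx)); exact: ler_norm.
- exact: integrableZl.
Qed.

(** * Vanishing moments on a bounded interval force a function to be zero almost everywhere *)

Section Moments.
Variable R : realType.
Local Notation mu := (@lebesgue_measure R).
Variables (B : R) (u : R -> R).
Local Notation D := `[- B, B]%classic.
Hypothesis iu : mu.-integrable D (EFin \o u).

Lemma polynomial_bounded (p : {poly R}) :
  exists M : R, forall x, D x -> `|p.[x]| <= M.
Proof.
elim/poly_ind: p => [|p c [M hM]]; first by exists 0 => x _; rewrite horner0 normr0.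
exists (M * `|B| + `|c|) => x Dx; rewrite hornerMXaddC.
apply: (le_trans (ler_normD _ _)); rewrite lerD2r normrM ler_pM//; first exact: hM.
move: Dx; rewrite /= in_itv/= => /andP[h1 h2].
by rewrite ler_norml; have := ler_norm B; lra.
Qed.

Lemma measurable_horner (p : {poly R}) : measurable_fun D (fun x => p.[x]).
Proof.
elim/poly_ind: p => [|p c ih].
  rewrite [X in measurable_fun _ X](_ : _ = cst 0)//.
  by apply/funext => x; rewrite horner0.
rewrite [X in measurable_fun _ X](_ : _ = fun x => p.[x] * x + c); last first.
  by apply/funext => x; rewrite hornerMXaddC.
by apply: measurable_funD => //; apply: measurable_funM.
Qed.

Hypothesis moments0 : forall n, \int[mu]_(x in D) (x ^+ n * u x) = 0.

Lemma polynomial_integral0 (p : {poly R}) : \int[mu]_(x in D) (p.[x] * u x) = 0.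
Proof.
have iM (q : {poly R}) : mu.-integrable D (EFin \o (fun x => q.[x] * u x)).
  have [M qM] := polynomial_bounded q.
  by apply: (integrable_bounded_mul (M := M)) => //; exact: measurable_horner.
(* Induction on [p] in the form [p * 'X + c] needs a free power ['X^n] that can absorb the new
   factor ['X]. *)
suff h : forall n, \int[mu]_(x in D) ((p * 'X^n).[x] * u x) = 0.
  by rewrite -[RHS](h 0%N); apply: eq_Rintegral => x _; rewrite mulr1.
elim/poly_ind: p => [|p c ih] n.
  under eq_Rintegral do rewrite mul0r horner0 mul0r.
  by rewrite Rintegral_cst// mul0r.
have iX : mu.-integrable D (EFin \o (fun x => x ^+ n * u x)).
  by apply: eq_integrable (iM 'X^n) => // x _ /=; rewrite hornerXn.
transitivity (\int[mu]_(x in D) ((p * 'X^(n.+1)).[x] * u x + c * (x ^+ n * u x))).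
  have e (x : R) : ((p * 'X + c%:P) * 'X^n).[x] * u x =
      (p * 'X^(n.+1)).[x] * u x + c * (x ^+ n * u x).
    by rewrite !(hornerM, hornerD, hornerC, hornerX, hornerXn) exprS; ring.
  by apply: eq_Rintegral => x _; exact: e.
have icX : mu.-integrable D (EFin \o (fun x => c * (x ^+ n * u x))).
  exact: (integrableZl _ _ iX).
rewrite (RintegralD _ (iM _) icX)//.
by rewrite ih RintegralZl// add0r moments0 mulr0.
Qed.

Lemma lower_integral0 (c : R) : - B < c < B ->
  \int[mu]_(x in D) ((x < c)%R%:R * u x) = 0.
Proof.
move=> /andP[Bc cB].
have B0 : 0 < B by lra.
(* The affine map sending [c] to the jump point 1/2. Since |x - c| <= 2B on the interval, the slope
   1/(4B) keeps its values in [0, 1], where [step_fun] is bounded and [|u|] dominates. *)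
pose s (x : R) := 2^-1 + (x - c) / (4 * B).
have sD x : D x -> 0 <= s x <= 1.
  rewrite /= in_itv/= => /andP[h1 h2]; rewrite /s.
  have : - 2^-1 <= (x - c) / (4 * B) by rewrite ler_pdivlMr; lra.
  have : (x - c) / (4 * B) <= 2^-1 by rewrite ler_pdivrMr; lra.
  by lra.
pose q : {poly R} := (2^-1 - c / (4 * B))%:P + (4 * B)^-1 *: 'X.
have qs x : q.[x] = s x by rewrite /q !hornerE /s; ring.
pose p n : {poly R} := (1 - q ^+ n) ^+ (2 ^ n).
have ps n x : (p n).[x] = step_fun n (s x).
  by rewrite /p /step_fun horner_exp hornerD hornerN hornerC horner_exp qs.
have mu' : measurable_fun D u.
  by apply/measurable_EFinP; exact: (measurable_int mu iu).
have mind : measurable_fun D (fun x => (x < c)%R%:R * u x).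
  apply: measurable_funM => //.
  rewrite (_ : (fun _ => _) = \1_`]-oo, c[%classic); first exact: measurable_indic.
  by apply/funext => x; rewrite indicE mem_setE in_itv.
have [|||||_ _ L] := @dominated_convergence _ _ R mu D (measurable_itv _)
  (fun n x => ((p n).[x] * u x)%:E) (fun x => ((x < c)%R%:R * u x)%:E)
  (fun x => `|u x|%:E).
- move=> n; apply/measurable_EFinP; apply: measurable_funM => //.
  exact: measurable_horner.
- exact/measurable_EFinP.
(* At [x = c] the polynomials take the value (1 - 2^-n)^(2^n), which tends to 1/e and not to the
   indicator; this point is discarded as a null set. *)
- exists [set c]; split => //; first exact: lebesgue_measure_set1.
  move=> x /=; apply: contra_notP => /= xc Dx; apply: cvg_EFin; first exact: nearW.
  have [s0 s1] := andP (sD _ Dx).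
  apply: cvgMl; under eq_fun do rewrite ps.
  have B40 : 0 < 4 * B by lra.
  have [xlt|xge] := ltP x c.
    apply: step_fun_cvg1; rewrite s0 /s gtrDl pmulr_llt0 ?invr_gt0//.
    by rewrite subr_lt0.
  apply: step_fun_cvg0; rewrite s1 /s ltrDl pmulr_lgt0 ?invr_gt0// andbT.
  by rewrite subr_gt0 lt_neqAle xge andbT eq_sym; exact/eqP.
- exact: (integrable_norm iu).
- apply: aeW => x n Dx; rewrite lee_fin normrM ps ger0_norm; last first.
    by have /andP[] := step_fun_itv n (sD _ Dx).
  by apply: ler_piMl => //; have /andP[] := step_fun_itv n (sD _ Dx).
have L0 : (fun n => \int[mu]_(x in D) ((p n).[x] * u x)%:E)%E = cst 0%E.
  apply/funext => n; rewrite -[LHS]fineK ?[fine _]polynomial_integral0//.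
  apply: integrable_fin_num => //.
  have [M pM] := polynomial_bounded (p n).
  by apply: (integrable_bounded_mul (M := M)) => //; exact: measurable_horner.
rewrite /Rintegral; have /cvg_lim <- // := L.
by rewrite L0 lim_cst.
Qed.

(** By [lower_integral0] the primitive of [u], extended by 0, vanishes on the open interval;
    Lebesgue differentiation recovers [u] from it almost everywhere. *)
Lemma moments_eq0_ae : {ae mu, forall x, - B < x < B -> u x = 0}.
Proof.
pose f := u \_ D.
have fi : mu.-integrable setT (EFin \o f).
  rewrite /f -restrict_EFin; exact: ((integrable_mkcond _ _).1 iu).
have F0 c : - B < c < B -> \int[mu]_(x in `]-oo, c]) f x = 0.
  move=> Bc.
  rewrite -Rintegral_itv_bndo_bndc; last exact: integrableS fi.
  rewrite -[RHS](lower_integral0 Bc) Rintegral_mkcond [RHS]Rintegral_mkcond.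
  apply: eq_Rintegral => x _; rewrite /f !patchE !mem_setE in_itv/=.
  by case: (x < c); case: (_ \in _) => //; rewrite ?mul1r ?mul0r.
have fl : locally_integrable setT f by exact: integrable_locally_restrict.
have fiy y : mu.-integrable `]-oo, y] (EFin \o f) by exact: integrableS fi.
have := FTC1Ny fiy fl; apply: filterS => x [_ dF] Bx.
have fx : f x = u x.
  by rewrite /f patchE mem_setE in_itv/=; case/andP: Bx => /ltW-> /ltW->.
rewrite -fx -dF -[RHS](derive1_cst (0 : R) x) !derive1E.
apply: near_eq_derive.
have : x \in `]- B, B[ by rewrite in_itv.
by move=> /near_in_itvoo; apply: filterS => y; rewrite in_itv => /F0.
Qed.

End Moments.

(** * Uniqueness for Fourier transforms known on an interval of frequencies *)

Section FourierUniqueness.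
Variable R : realType.
Local Notation mu := (@lebesgue_measure R).
Variables (B kmin kmax : R) (h1 h2 : R -> R).
Local Notation D := `[- B, B]%classic.
Hypothesis ih1 : mu.-integrable D (EFin \o h1).
Hypothesis ih2 : mu.-integrable D (EFin \o h2).

(* The phase p makes differentiation in k act as a shift of p by pi/2. *)
Definition phase_moment (n : nat) (p k a : R) : R :=
  a ^+ n * (cos (k * a + p) * h1 a - sin (k * a + p) * h2 a).

Lemma integrable_phase_moment n p k :
  mu.-integrable D (EFin \o phase_moment n p k).
Proof.
have mc : measurable_fun [set: R] (fun a : R => k * a + p) by exact: measurable_funD.
have mcos : measurable_fun [set: R] (@cos R).
  by apply: continuous_measurable_fun; exact: continuous_cos.
have msin : measurable_fun [set: R] (@sin R).
  by apply: continuous_measurable_fun; exact: continuous_sin.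
have aB (a : R) : D a -> `|a| <= `|B|.
  by rewrite /= in_itv/= => /andP[h h']; rewrite ler_norml; have := ler_norm B; lra.
have i1 : mu.-integrable D
    (EFin \o (fun a => (a ^+ n * cos (k * a + p)) * h1 a)).
  apply: (integrable_bounded_mul _ ih1 (M := `|B| ^+ n)) => //.
    apply: measurable_funTS; apply: measurable_funM.
      exact: exprn_measurable.
    exact: (measurableT_comp mcos mc).
  move=> a Da; rewrite normrM normrX -[leRHS]mulr1 ler_pM// ?exprn_ge0//.
    by rewrite lerXn2r// ?nnegrE//; exact: aB.
  by rewrite ler_norml cos_geN1 cos_le1.
have i2 : mu.-integrable D
    (EFin \o (fun a => (a ^+ n * sin (k * a + p)) * h2 a)).
  apply: (integrable_bounded_mul _ ih2 (M := `|B| ^+ n)) => //.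
    apply: measurable_funTS; apply: measurable_funM.
      exact: exprn_measurable.
    exact: (measurableT_comp msin mc).
  move=> a Da; rewrite normrM normrX -[leRHS]mulr1 ler_pM// ?exprn_ge0//.
    by rewrite lerXn2r// ?nnegrE//; exact: aB.
  by rewrite ler_norml sin_geN1 sin_le1.
apply: eq_integrable (integrableB _ i1 i2) => // a _ /=.
by rewrite -EFinB /phase_moment mulrBr !mulrA.
Qed.

Lemma derive_phase_moment n p (a k : R) :
  is_derive k 1 (fun k => phase_moment n p k a) (phase_moment n.+1 (p + pi / 2) k a).
Proof.
have dl : is_derive k 1 (fun k : R => k * a + p) a.
  by apply: is_derive_eq; rewrite /GRing.scale/= mulr0 add0r addr0 mulr1.
have dc : is_derive k 1 (fun k : R => cos (k * a + p)) (- sin (k * a + p) * a).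
  exact: (@is_derive1_comp _ (@cos R)).
have ds : is_derive k 1 (fun k : R => sin (k * a + p)) (cos (k * a + p) * a).
  exact: (@is_derive1_comp _ (@sin R)).
rewrite /phase_moment addrA cosDpihalf sinDpihalf.
have d1 := is_deriveM dc (is_derive_cst (h1 a) k 1).
have d2 := is_deriveM ds (is_derive_cst (h2 a) k 1).
apply: (is_derive_eq (is_deriveZ (a ^+ n) (is_deriveB d1 d2))).
by rewrite /GRing.scale/= exprS; ring.
Qed.

Hypothesis phase0 : forall p k, kmin < k < kmax ->
  \int[mu]_(a in D) phase_moment 0 p k a = 0.

(** An integral that vanishes for all [k] of an open interval has zero derivative there, and each
    derivative brings down one more factor [a]. *)
Lemma phase_moment_integral0 n p k : kmin < k < kmax ->
  \int[mu]_(a in D) phase_moment n p k a = 0.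
Proof.
elim: n p k => [|n ih] p k Kk; first exact: phase0.
have Ik : `]kmin, kmax[%classic k by rewrite /= in_itv.
(* Differentiation adds pi/2 to the phase, so the induction hypothesis is taken at [p - pi / 2] in
   order to land on [p]. *)
pose f k a := phase_moment n (p - pi / 2) k a.
have d1 x a : partial1of2 f x a = phase_moment n.+1 p x a.
  rewrite partial1of2E (@derive_val _ _ _ _ _ _ _ (derive_phase_moment _ _ _ _)).
  by rewrite subrK.
have aB (a : R) : D a -> `|a| <= `|B|.
  by rewrite /= in_itv/= => /andP[h h']; rewrite ler_norml; have := ler_norm B; lra.
have iG : mu.-integrable D (EFin \o (fun a => `|B| ^+ n.+1 * (`|h1 a| + `|h2 a|))).
  have h12 := integrableD _ (integrable_norm ih1) (integrable_norm ih2).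
  exact: (integrableZl _ (`|B| ^+ n.+1) (h12 _)).
have G0 a : 0 <= `|B| ^+ n.+1 * (`|h1 a| + `|h2 a|).
  by rewrite mulr_ge0 ?exprn_ge0// addr_ge0.
have Gub x a : `]kmin, kmax[%classic x -> D a ->
    `|partial1of2 f x a| <= `|B| ^+ n.+1 * (`|h1 a| + `|h2 a|).
  move=> _ Da; rewrite d1 /phase_moment normrM normrX ler_pM ?exprn_ge0//.
    by rewrite lerXn2r// ?nnegrE//; exact: aB.
  apply: (le_trans (ler_normB _ _)); rewrite !normrM.
  by rewrite lerD// ler_piMl ?cos_max ?sin_max.
transitivity (\int[mu]_(a in D) partial1of2 f k a).
  by apply: eq_Rintegral => a _; rewrite d1.
rewrite -(@differentiation_under_integral _ _ _ mu f D (measurable_itv _) k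
  kmin kmax Ik (fun x _ => integrable_phase_moment n (p - pi / 2) x)
  (fun x y _ _ => @ex_derive _ _ _ _ _ _ _ (derive_phase_moment _ _ y x))
  _ G0 iG Gub).
rewrite derive1E -[RHS](derive_cst (0 : R) k (1 : R)).
apply: near_eq_derive; have : k \in `]kmin, kmax[ by rewrite in_itv.
by move=> /near_in_itvoo; apply: filterS => y; rewrite in_itv/= => Ky; exact: ih.
Qed.

Hypothesis Kn0 : kmin < kmax.

(** Phases 0 and -pi/2 give the real and imaginary parts of e^{ika}(h1 + i h2). Both have zero
    moments, hence vanish almost everywhere, and undoing the rotation by e^{ika} gives [h1] and
    [h2]. *)
Lemma fourier_eq0_ae : {ae mu, forall a, - B < a < B -> h1 a = 0 /\ h2 a = 0}.
Proof.
pose k := (kmin + kmax) / 2.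
have Kk : kmin < k < kmax by rewrite /k !(midf_lt Kn0).
have m0 p : {ae mu, forall a, - B < a < B -> phase_moment 0 p k a = 0}.
  apply: moments_eq0_ae; first exact: integrable_phase_moment.
  move=> n; rewrite -[RHS](phase_moment_integral0 n p Kk).
  by apply: eq_Rintegral => a _; rewrite /phase_moment expr0 mul1r.
apply: filterS2 (m0 0) (m0 (- (pi / 2))) => a H1 H2 Ba.
move: (H1 Ba) (H2 Ba).
rewrite /phase_moment !expr0 !mul1r addr0 cosBpihalf sinBpihalf mulNr opprK.
set c := cos _; set s := sin _ => e1 e2.
have cs : c ^+ 2 + s ^+ 2 = 1 by exact: cos2Dsin2.
have E1 : (c ^+ 2 + s ^+ 2) * h1 a =
    c * (c * h1 a - s * h2 a) + s * (s * h1 a + c * h2 a) by ring.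
have E2 : (c ^+ 2 + s ^+ 2) * h2 a =
    c * (s * h1 a + c * h2 a) - s * (c * h1 a - s * h2 a) by ring.
move: E1 E2; rewrite cs e1 e2 !mulr0 subr0 addr0 !mul1r.
by split.
Qed.

End FourierUniqueness.

(** * Change of variables under a measure-preserving map *)

Section ChangeOfVariables.
Context {d} {T : measurableType d} {R : realType}.
Variables (mu : {measure set T -> \bar R}) (g : T -> T).
Hypothesis gP : measure_preserving mu g.

Lemma negligible_preserving (N : set T) :
  mu.-negligible N -> mu.-negligible (g @^-1` N).
Proof.
move=> [A [mA A0 NA]]; exists (g @^-1` A); split.
- by rewrite -[X in measurable X]setTI; exact: gP.1.
- by rewrite gP.2.
- by move=> x /NA.
Qed.

Lemma eq_integral_pushforward_preserving (f : T -> \bar R) :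
  (\int[pushforward mu g]_x f x = \int[mu]_x f x)%E.
Proof.
pose mix := isMeasurableFun.Build _ _ _ _ _ gP.1.
pose g' : {mfun T >-> T} := HB.pack g mix.
rewrite -[pushforward mu g]/(pushforward mu g').
by apply: eq_measure_integral => A mA _; exact: gP.2.
Qed.

Lemma ge0_integral_preserving (f : T -> \bar R) : measurable_fun setT f ->
  (forall x, 0 <= f x)%E -> (\int[mu]_x f (g x) = \int[mu]_x f x)%E.
Proof.
move=> mf f0; rewrite -[RHS]eq_integral_pushforward_preserving.
by rewrite ge0_integral_pushforward//; exact: gP.1.
Qed.

Lemma integrable_preserving (f : T -> \bar R) :
  mu.-integrable setT f -> mu.-integrable setT (f \o g).
Proof.
move=> /integrableP[mf foo]; apply/integrableP; split.
  by apply: measurableT_comp => //; exact: gP.1.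
by rewrite (@ge0_integral_preserving (abse \o f))//=; exact: measurableT_comp.
Qed.

Lemma integral_preserving (f : T -> \bar R) :
  mu.-integrable setT f -> (\int[mu]_x f (g x) = \int[mu]_x f x)%E.
Proof.
move=> fi; rewrite -[RHS]eq_integral_pushforward_preserving integral_pushforward//.
- exact: gP.1.
- exact: measurable_int fi.
- exact: integrable_preserving.
Qed.

End ChangeOfVariables.

(** * Fubini and Tonelli for real-valued integrals over slices *)

Section SliceIntegral.
Context {d1 d2} {T1 : measurableType d1} {T2 : measurableType d2} {R : realType}.
Variables (m1 : {sigma_finite_measure set T1 -> \bar R})
          (m2 : {sigma_finite_measure set T2 -> \bar R}).
Variable (f : T1 * T2 -> R).

(** A real number is returned even on slices where [f] is not integrable; such [y] form a null set,
    so statements about single slices are made almost everywhere. *)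
Definition slice_integral (y : T2) : R := \int[m1]_x f (x, y).

Hypothesis fi : (m1 \x m2)%E.-integrable setT (EFin \o f).

Lemma measurable_slice_integral : measurable_fun setT slice_integral.
Proof.
exact: (measurableT_comp (fine_measurable measurableT) (measurable_fubini_G fi)).
Qed.

Lemma ae_integrable_slice : {ae m2, forall y,
  m1.-integrable setT (fun x => (f (x, y))%:E)}.
Proof. exact: (ae_integrable2 fi). Qed.

Let le_slice y : m1.-integrable setT (fun x => (f (x, y))%:E) ->
  (`|(slice_integral y)%:E| <= \int[m1]_x `|f (x, y)|%:E)%E.
Proof.
move=> iy; rewrite /slice_integral /Rintegral fineK; last exact: integrable_fin_num.
by apply: le_abse_integral => //; exact: measurable_int iy.
Qed.

Lemma integrable_slice_integral : m2.-integrable setT (EFin \o slice_integral).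
Proof.
apply/integrableP; split.
  by apply/measurable_EFinP; exact: measurable_slice_integral.
have := (integrable21ltyP m1 m2 (measurable_int _ fi)).1 fi; apply: le_lt_trans.
apply: ae_ge0_le_integral => //.
- apply: measurableT_comp => //; apply/measurable_EFinP.
  exact: measurable_slice_integral.
- by move=> y _; exact: integral_ge0.
- apply: (measurable_fun_fubini_tonelli_G (abse \o (EFin \o f))) => //=.
  by apply: measurableT_comp => //; exact: measurable_int fi.
by apply: filterS ae_integrable_slice => y iy _; exact: le_slice.
Qed.

Lemma Rintegral_mul_slice (phi : T2 -> R) (M : R) : measurable_fun setT phi ->
  (forall y, `|phi y| <= M) ->
  \int[(m1 \x m2)%E]_z (phi z.2 * f z) = \int[m2]_y (phi y * slice_integral y).
Proof.
move=> mphi phiM.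
have mphi2 : measurable_fun setT (fun z : T1 * T2 => phi z.2).
  exact: measurableT_comp.
have ip : (m1 \x m2)%E.-integrable setT (fun z => (phi z.2 * f z)%:E).
  exact: (integrable_bounded_mul measurableT fi mphi2 (fun z _ => phiM z.2)).
rewrite /Rintegral -(integral21_prod_meas1 ip); congr fine.
apply: ae_eq_integral => //.
- exact: (measurable_fubini_G ip).
- apply/measurable_EFinP; apply: measurable_funM => //.
  exact: measurable_slice_integral.
apply: filterS ae_integrable_slice => y iy _ /=.
rewrite /fubini_G /= EFinM /slice_integral /Rintegral fineK; last first.
  exact: integrable_fin_num.
by rewrite -integralZl.
Qed.

(** By Tonelli the slice integrals of |f| have integral 0, so almost all of them are 0, and they
    bound [slice_integral] in absolute value. *)
Lemma slice_integral_eq0_ae : {ae (m1 \x m2)%E, forall z, f z = 0} ->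
  {ae m2, forall y, slice_integral y = 0}.
Proof.
move=> f0.
have mabs : measurable_fun setT (abse \o (EFin \o f)).
  by apply: measurableT_comp => //; exact: measurable_int fi.
have I0 : (\int[m2]_y `|\int[m1]_x `|f (x, y)|%:E| = 0)%E.
  transitivity (\int[m2]_y fubini_G m1 (abse \o (EFin \o f)) y)%E.
    apply: eq_integral => y _; rewrite gee0_abs//.
    by apply: integral_ge0.
  rewrite -fubini_tonelli2//; last by move=> z; exact: abse_ge0.
  have [_] := @ae_eq_integral_abs _ _ _ (m1 \x m2)%E setT measurableT (EFin \o f)
    (measurable_int _ fi).
  by apply; apply: filterS f0 => z /= -> _.
pose G y := (\int[m1]_x `|f (x, y)|%:E)%E.
have mG : measurable_fun setT G.
  by apply: (measurable_fun_fubini_tonelli_G _ mabs) => z; exact: abse_ge0.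
have [h _] := @ae_eq_integral_abs _ _ _ m2 setT measurableT G mG.
apply: filterS2 (h I0) ae_integrable_slice => y /(_ I) hy iy.
have := le_slice iy; rewrite -/(G y) hy /= lee_fin normr_le0.
by move=> /eqP.
Qed.

End SliceIntegral.

(** * A source vanishes almost everywhere off its essential support *)

Section EssentialSupport.
Variable R : realType.
Local Notation R3 := (R * R * R)%type.
Local Notation C := (complex R).
Implicit Types (J : R3 -> C * C * C) (y : R3).

(** A base of the topology whose index type is countable, so that the null boxes can be united into
    a null set. *)
Definition rational_box (i : rat * rat * rat * nat) : set R3 :=
  [set y : R3 | [/\ `|y.1.1 - ratr i.1.1.1| < i.2.+1%:R^-1,
                    `|y.1.2 - ratr i.1.1.2| < i.2.+1%:R^-1 &
                    `|y.2 - ratr i.1.2| < i.2.+1%:R^-1]].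

Lemma rational_box_basis (U : set R3) y : open U -> U y ->
  exists i, rational_box i y /\ rational_box i `<=` U.
Proof.
move=> oU Uy; have /nbhs_ballP[e /= e0 yU] : nbhs y U by exact: open_nbhs_nbhs.
have e20 : 0 < e / 2 by rewrite divr_gt0.
have [n _ /(_ n (leqnn n)) /= ne] := near_infty_natSinv_lt (PosNum e20).
have n0 : 0 < (n.+1%:R^-1 : R) by rewrite invr_gt0.
have [r rE] : exists r : R, r = n.+1%:R^-1 by exists n.+1%:R^-1.
rewrite -rE in ne n0.
have rat_near (x : R) : exists q : rat, `|x - ratr q| < n.+1%:R^-1.
  rewrite -rE.
  have xr : x - r < x + r by lra.
  have [q] := @rat_in_itvoo R (x - r) (x + r) xr.
  rewrite in_itv/= => /andP[h1 h2]; exists q.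
  by rewrite ltr_norml; apply/andP; split; lra.
have [[q1 h1] [q2 h2] [q3 h3]] := And3 (rat_near y.1.1) (rat_near y.1.2) (rat_near y.2).
exists (q1, q2, q3, n); split => // z [/= g1 g2 g3]; apply: yU.
have tri (a b q : R) : `|a - q| < n.+1%:R^-1 -> `|b - q| < n.+1%:R^-1 -> `|a - b| < e.
  by rewrite -rE !ltr_norml => /andP[? ?] /andP[? ?]; apply/andP; split; lra.
by split; [split; [exact: tri h1 g1|exact: tri h2 g2]|exact: tri h3 g3].
Qed.

(** A Lindelof argument: around a point off the support [J] is null on some open set, hence on a
    rational box, and there are only countably many such boxes. *)
Lemma negligible_off_esupp J :
  (@leb3 R).-negligible ([set y | J y != 0] `\` esupp J).
Proof.
pose N i := rational_box i `&` [set y | J y != 0].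
pose F k : set R3 := if unpickle k is Some i then
  (if asbool ((@leb3 R).-negligible (N i)) then N i else set0) else set0.
have : (@leb3 R).-negligible (\bigcup_k F k).
  apply: negligible_bigcup => k; rewrite /F.
  case: (unpickle k) => [i|]; last exact: negligible_set0.
  by case: asboolP => // _; exact: negligible_set0.
apply: negligibleS => y [/= Jy].
move=> /existsNP[U /not_implyP[oU /not_implyP[Uy /contrapT UN]]].
have [i [iy iU]] := rational_box_basis oU Uy.
have Ni : (@leb3 R).-negligible (N i).
  by apply: negligibleS UN => z [/iU Uz Jz].
exists (pickle i); first exact: I.
rewrite /F pickleK; by case: asboolP.
Qed.

Lemma ae_off_esupp J : {ae @leb3 R, forall y, ~ esupp J y -> J y = 0}.
Proof.
apply: negligibleS (negligible_off_esupp J) => y /= /not_implyP[h1 h2].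
by split => //; exact/eqP.
Qed.

Lemma compact_coords_bounded (D : set R3) : compact D ->
  exists M : R, forall y, D y -> [/\ `|y.1.1| <= M, `|y.1.2| <= M & `|y.2| <= M].
Proof.
move=> cD; have [M [_ hM]] := compact_bounded cD.
exists (M + 1) => y Dy; have := hM (M + 1) _ y Dy; rewrite ltrDl ltr01 => /(_ isT).
rewrite /= prod_normE ge_max prod_normE ge_max.
by move=> /andP[/andP[]].
Qed.

End EssentialSupport.

(** * Recovering a complex number from three moduli *)

Section PhaseRetrieval.
Variable R : realType.
Local Notation C := (complex R).

Lemma normc_eq_sqr (z w : C) : `|z| = `|w| ->
  complex.Re z ^+ 2 + complex.Im z ^+ 2 = complex.Re w ^+ 2 + complex.Im w ^+ 2.
Proof.
case: z w => [a b] [c d]; rewrite !normc_def /= => -[] h.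
have p x y : 0 <= x ^+ 2 + y ^+ 2 :> R by rewrite addr_ge0 ?sqr_ge0.
by rewrite -(sqr_sqrtr (p a b)) h sqr_sqrtr.
Qed.

(** Squaring the moduli and subtracting the equation at [t1] leaves Re((a - b) conj(c) conj(t_j -
    t_1)) = 0 for j = 2, 3: as a plane vector, (a - b) conj(c) is orthogonal to two independent
    directions, so it is 0. *)
Lemma phase_retrieval (t1 t2 t3 a b c : C) :
  (forall x y : R, x%:C * (t2 - t1) + y%:C * (t3 - t1) = 0 -> x = 0 /\ y = 0) ->
  c != 0 -> `|a + c * t1| = `|b + c * t1| -> `|a + c * t2| = `|b + c * t2| ->
  `|a + c * t3| = `|b + c * t3| -> a = b.
Proof.
move: t1 t2 t3 a b c => [t1 s1] [t2 s2] [t3 s3] [a1 a2] [b1 b2] [c1 c2] ind c0.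
move=> /normc_eq_sqr /= e1 /normc_eq_sqr /= e2 /normc_eq_sqr /= e3.
(* [d1] and [d2] are the real and imaginary parts of (a - b) conj(c). *)
pose d1 := (a1 - b1) * c1 + (a2 - b2) * c2.
pose d2 := (a2 - b2) * c1 - (a1 - b1) * c2.
have E2 : d1 * (t2 - t1) + d2 * (s2 - s1) = 0 by rewrite /d1 /d2; lra.
have E3 : d1 * (t3 - t1) + d2 * (s3 - s1) = 0 by rewrite /d1 /d2; lra.
have det0 : (t2 - t1) * (s3 - s1) - (s2 - s1) * (t3 - t1) != 0.
  apply/eqP => D0.
  have ind' (x y : R) : x * (t2 - t1) + y * (t3 - t1) = 0 ->
      x * (s2 - s1) + y * (s3 - s1) = 0 -> x = 0 /\ y = 0.
    move=> h1 h2; apply: ind; apply/eqP; rewrite eq_complex /=.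
    by apply/andP; split; apply/eqP; [rewrite -[RHS]h1|rewrite -[RHS]h2]; ring.
  (* If the determinant were 0, the real parts would be coefficients of a linear relation, and so
     would the imaginary parts. Independence makes all of them 0, and then 1, 0 is a forbidden
     relation. *)
  have [||v1 u1] := ind' (t3 - t1) (- (t2 - t1)); [ring|lra|].
  have [||v2 u2] := ind' (s3 - s1) (- (s2 - s1)); [lra|ring|].
  have [||/eqP] := ind' 1 0; [lra|lra|].
  by rewrite oner_eq0.
have z1 : d1 = 0.
  apply: (mulIf det0); rewrite mul0r -[RHS](subrr 0) -{1}[0](mulr0 (s3 - s1)) -{1}E2.
  by rewrite -(mulr0 (s2 - s1)) -E3; ring.
have z2 : d2 = 0.
  apply: (mulIf det0); rewrite mul0r -[RHS](subrr 0) -{1}[0](mulr0 (t2 - t1)) -{1}E3.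
  by rewrite -(mulr0 (t3 - t1)) -E2; ring.
have c0' : c1 ^+ 2 + c2 ^+ 2 != 0.
  rewrite paddr_eq0 ?sqr_ge0// !sqrf_eq0; apply: contra c0 => /andP[/eqP-> /eqP->].
  by [].
have h1 : a1 - b1 = 0.
  apply: (mulIf c0'); transitivity (d1 * c1 - d2 * c2); first by rewrite /d1 /d2; ring.
  by rewrite z1 z2 !mul0r subrr.
have h2 : a2 - b2 = 0.
  apply: (mulIf c0'); transitivity (d1 * c2 + d2 * c1); first by rewrite /d1 /d2; ring.
  by rewrite z1 z2 !mul0r addr0.
by congr Complex; lra.
Qed.

End PhaseRetrieval.

(** * Integrability of bounded sources with compact support *)

Section SourceIntegrability.
Variable R : realType.
Local Notation R3 := (R * R * R)%type.
Local Notation C := (complex R).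
Local Notation leb := (@lebesgue_measure R).
Implicit Types (J : R3 -> C * C * C) (y : R3).

Definition cube (M : R) : set R3 := `[- M, M] `*` `[- M, M] `*` `[- M, M].

Lemma leb3_cube (M : R) : (@leb3 R (cube M) < +oo)%E.
Proof.
pose I : set (measurableTypeR R) := `[- M, M]%classic.
have mI : measurable I by exact: measurable_itv.
have I_lt : (leb I < +oo)%E.
  by rewrite lebesgue_measure_itv/=; case: ifPn; rewrite ?ltry.
have I2_lt : (@leb2 R (I `*` I) < +oo)%E.
  have -> : @leb2 R (I `*` I) = (leb I * leb I)%E by exact: product_measure1E.
  by rewrite lte_mul_pinfty// ge0_fin_numE.
have -> : @leb3 R (cube M) = (@leb2 R (I `*` I) * leb I)%E.
  by apply: (product_measure1E (@leb2 R) leb) => //; exact: measurableX.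
by rewrite lte_mul_pinfty// ge0_fin_numE.
Qed.

Lemma integrable_ess_bounded (g : R3 -> R) (D : set R3) (B M : R) :
  measurable_fun setT g -> {ae @leb3 R, forall y, `|g y| <= M} ->
  (forall y, D y -> [/\ `|y.1.1| <= B, `|y.1.2| <= B & `|y.2| <= B]) ->
  {ae @leb3 R, forall y, ~ D y -> g y = 0} ->
  (@leb3 R).-integrable setT (EFin \o g).
Proof.
move=> mg gM DB gD; pose Q := cube B.
have mQ : measurable Q by apply: measurableX => //; exact: measurableX.
apply/integrableP; split; first exact/measurable_EFinP.
(* [|M|] gives a nonnegative constant without examining the sign of [M]. *)
apply: (@le_lt_trans _ _ (\int[@leb3 R]_y (`|M| * \1_Q y)%:E)%E); last first.
  under eq_integral do rewrite EFinM.
  rewrite ge0_integralZl//; last by apply/measurable_EFinP; exact: measurable_indic.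
  by rewrite integral_indic// setIT lte_mul_pinfty//; exact: leb3_cube.
apply: ae_ge0_le_integral => //.
- by apply: measurableT_comp => //; exact/measurable_EFinP.
- apply/measurable_EFinP; apply: measurable_funM => //; exact: measurable_indic.
apply: filterS2 gM gD => y gM gD _ /=; rewrite lee_fin indicE.
case: (boolP (y \in Q)) => yQ; first by rewrite mulr1 (le_trans gM)// ler_norm.
rewrite mulr0 gD ?normr0// => /DB[h1 h2 h3]; move: yQ; rewrite notin_setE; apply.
by split; [split|]; rewrite /= in_itv/= -ler_norml.
Qed.

Lemma Linfty3_integrable J : Linfty3 J -> compact (esupp J) ->
  [/\ (@leb3 R).-integrable setT (fun y => (complex.Re (J y).1.1)%:E) /\
      (@leb3 R).-integrable setT (fun y => (complex.Im (J y).1.1)%:E),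
      (@leb3 R).-integrable setT (fun y => (complex.Re (J y).1.2)%:E) /\
      (@leb3 R).-integrable setT (fun y => (complex.Im (J y).1.2)%:E) &
      (@leb3 R).-integrable setT (fun y => (complex.Re (J y).2)%:E) /\
      (@leb3 R).-integrable setT (fun y => (complex.Im (J y).2)%:E)].
Proof.
move=> [[m1 m2] [m3 m4] [m5 m6] [M JM]] cJ.
have [B DB] := compact_coords_bounded cJ.
have hRe (z : C) : `|z| <= M%:C -> `|complex.Re z| <= M.
  by move=> zM; rewrite -lecR (le_trans _ zM)// normc_ge_Re.
have hIm (z : C) : `|z| <= M%:C -> `|complex.Im z| <= M.
  case: z => a b zM; rewrite -lecR (le_trans _ zM)// normc_def lecR/=.
  by rewrite -sqrtr_sqr ler_wsqrtr// lerDr sqr_ge0.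
split; split; apply: (@integrable_ess_bounded _ (esupp J) B M) => //;
  solve [by apply: filterS JM => y [? ? ?]; auto
        | by apply: filterS (ae_off_esupp J) => y h /h ->].
Qed.

Lemma dotRC3_cint3v (m : R3) (G : R3 -> C * C * C) :
  [/\ (@leb3 R).-integrable setT (fun y => (complex.Re (G y).1.1)%:E) /\
      (@leb3 R).-integrable setT (fun y => (complex.Im (G y).1.1)%:E),
      (@leb3 R).-integrable setT (fun y => (complex.Re (G y).1.2)%:E) /\
      (@leb3 R).-integrable setT (fun y => (complex.Im (G y).1.2)%:E) &
      (@leb3 R).-integrable setT (fun y => (complex.Re (G y).2)%:E) /\
      (@leb3 R).-integrable setT (fun y => (complex.Im (G y).2)%:E)] ->
  dotRC3 m (cint3v G) = cint3 (fun y => dotRC3 m (G y)).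
Proof.
have lin (g1 g2 g3 : R3 -> R) : (@leb3 R).-integrable setT (EFin \o g1) ->
    (@leb3 R).-integrable setT (EFin \o g2) ->
    (@leb3 R).-integrable setT (EFin \o g3) ->
    \int[@leb3 R]_y (m.1.1 * g1 y + m.1.2 * g2 y + m.2 * g3 y) =
    m.1.1 * \int[@leb3 R]_y g1 y + m.1.2 * \int[@leb3 R]_y g2 y +
      m.2 * \int[@leb3 R]_y g3 y.
  move=> i1 i2 i3.
  have z1 : (@leb3 R).-integrable setT (EFin \o (fun y => m.1.1 * g1 y)).
    exact: (integrableZl _ _ i1).
  have z2 : (@leb3 R).-integrable setT (EFin \o (fun y => m.1.2 * g2 y)).
    exact: (integrableZl _ _ i2).
  have z3 : (@leb3 R).-integrable setT (EFin \o (fun y => m.2 * g3 y)).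
    exact: (integrableZl _ _ i3).
  have z12 : (@leb3 R).-integrable setT
      (EFin \o (fun y => m.1.1 * g1 y + m.1.2 * g2 y)).
    exact: (integrableD _ z1 z2).
  by rewrite (RintegralD _ z12 z3)// (RintegralD _ z1 z2)// !RintegralZl.
move=> [[r1 i1] [r2 i2] [r3 i3]].
rewrite /dotRC3 /cint3v /cint3 /=; apply/eqP; rewrite eq_complex /=.
rewrite !(mul0r, subr0, addr0) -(lin _ _ _ r1 r2 r3) -(lin _ _ _ i1 i2 i3).
apply/andP; split; apply/eqP; apply: eq_Rintegral => y _;
  by case: (G y) => [[[? ?] [? ?]] [? ?]] /=; rewrite !(mul0r, subr0, addr0).
Qed.

End SourceIntegrability.

(** * The far field in plane coordinates, and the recovery of the depth range *)

Section FarField.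
Variable R : realType.
Local Notation R3 := (R * R * R)%type.
Local Notation C := (complex R).
Local Notation leb := (@lebesgue_measure R).
Variables x0 l m : R3.
Hypotheses (x0x0 : dotR3 x0 x0 = 1) (lx0 : dotR3 l x0 = 0)
  (mx0 : dotR3 m x0 = 0) (lmx0 : detR3 l m x0 = 1).
Implicit Types (J : R3 -> C * C * C) (y : R3) (f : R3 -> R) (k a : R).

(** The minus sign makes the third coordinate equal to the parameter [alpha] of the plane through
    the point, which turns the phase e^{-ik x0.y} into e^{ik alpha}. *)
Definition plane_coords (z : R3) : R3 := R3_basis_map l m (sclR3 (- 1) x0) z.

Lemma plane_coords_preserving : measure_preserving (@leb3 R) plane_coords.
Proof.
apply: basis_map_detN1; transitivity (- detR3 l m x0); last by rewrite lmx0.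
by rewrite /detR3 /dotR3 /crossR3 /sclR3 /=; ring.
Qed.

Lemma dot_plane_coords z : - dotR3 x0 (plane_coords z) = z.2.
Proof.
transitivity (z.2 * dotR3 x0 x0 - z.1.1 * dotR3 l x0 - z.1.2 * dotR3 m x0).
  by rewrite /dotR3 /plane_coords /R3_basis_map /addR3 /sclR3 /=; ring.
by rewrite x0x0 lx0 mx0; ring.
Qed.

Definition plane_integral f : R -> R :=
  slice_integral (@leb2 R) (fun z : R3 => f (plane_coords z)).

Lemma JhatE J a : Jhat x0 l m J a =
  Complex (plane_integral (fun y => complex.Re (dotRC3 m (J y))) a)
          (plane_integral (fun y => complex.Im (dotRC3 m (J y))) a).
Proof.
have e st : addR3 (sclR3 (- a) x0) (addR3 (sclR3 st.1 l) (sclR3 st.2 m)) =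
    plane_coords (st, a).
  by rewrite /plane_coords /R3_basis_map /addR3 /sclR3 /=; congr (_, _, _); ring.
by rewrite /Jhat /cint2 /plane_integral /slice_integral; congr Complex;
  apply: eq_Rintegral => st _; rewrite e.
Qed.

Lemma integrable_plane_coords f : (@leb3 R).-integrable setT (EFin \o f) ->
  (@leb3 R).-integrable setT (EFin \o (fun z => f (plane_coords z))).
Proof. by move=> /(integrable_preserving plane_coords_preserving). Qed.

Lemma integrable_plane_integral f : (@leb3 R).-integrable setT (EFin \o f) ->
  leb.-integrable setT (EFin \o plane_integral f).
Proof.
by move=> fi; apply: integrable_slice_integral; exact: integrable_plane_coords.
Qed.

Lemma measurable_depth : measurable_fun setT (fun y => - dotR3 x0 y).
Proof.
apply: (measurable_funN (f := fun y => dotR3 x0 y)); rewrite /dotR3.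
apply: measurable_funD; [apply: measurable_funD|]; apply: measurable_funM => //.
- exact: measurable_coord1.
- exact: measurable_coord2.
Qed.

(** A function of the depth is constant on each plane and leaves the inner integral. It is applied
    with cosine and sine for [phi]. *)
Lemma Rintegral_depth (phi : R -> R) (M : R) f :
  (@leb3 R).-integrable setT (EFin \o f) -> measurable_fun setT phi ->
  (forall a, `|phi a| <= M) ->
  \int[@leb3 R]_y (phi (- dotR3 x0 y) * f y) =
  \int[leb]_a (phi a * plane_integral f a).
Proof.
move=> fi mphi phiM.
have mp : measurable_fun setT (fun y => phi (- dotR3 x0 y)).
  exact: (measurableT_comp mphi measurable_depth).
have pi := integrable_bounded_mul measurableT fi mp (fun y _ => phiM _).
rewrite -(@Rintegral_mul_slice _ _ _ _ _ (@leb2 R) leb _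
  (integrable_plane_coords fi) phi M)//.
rewrite /Rintegral -(integral_preserving plane_coords_preserving pi); congr fine.
by apply: eq_integral => z _ /=; rewrite dot_plane_coords.
Qed.

(** Multiplying [f] by the indicator of [S] at the depth gives a function that is null on the whole
    space, while its slices at depths in [S] are those of [f]. *)
Lemma plane_integral_eq0_ae f (S : set R) :
  (@leb3 R).-integrable setT (EFin \o f) -> measurable S ->
  {ae @leb3 R, forall y, S (- dotR3 x0 y) -> f y = 0} ->
  {ae leb, forall a, S a -> plane_integral f a = 0}.
Proof.
move=> fi mS f0.
pose g y := \1_S (- dotR3 x0 y) * f y.
have gi : (@leb3 R).-integrable setT (EFin \o g).
  apply: (integrable_bounded_mul (M := 1)) => //.
    have m1 : measurable_fun [set: R] (\1_S : R -> R) by exact: measurable_indic.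
    exact: (measurableT_comp m1 measurable_depth).
  by move=> y _; rewrite indicE; case: (_ \in _); rewrite ?normr1 ?normr0.
have g0 : {ae @leb3 R, forall z, g (plane_coords z) = 0}.
  suff g0 : {ae @leb3 R, forall y, g y = 0}.
    exact: (negligible_preserving plane_coords_preserving g0).
  apply: filterS f0 => y fy; rewrite /g indicE.
  by case: (boolP (_ \in _)) => [/set_mem/fy ->|]; rewrite ?mulr0 ?mul0r.
have := @slice_integral_eq0_ae _ _ _ _ _ (@leb2 R) leb
  (fun z => g (plane_coords z)) (integrable_plane_coords gi) g0.
apply: filterS => a /= <- Sa; apply: eq_Rintegral => st _.
by rewrite /g dot_plane_coords indicE mem_set//= mul1r.
Qed.

Lemma integrable_dotRC3 J : Linfty3 J -> compact (esupp J) ->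
  (@leb3 R).-integrable setT (EFin \o (fun y => complex.Re (dotRC3 m (J y)))) /\
  (@leb3 R).-integrable setT (EFin \o (fun y => complex.Im (dotRC3 m (J y)))).
Proof.
move=> LJ cJ; have [[r1 i1] [r2 i2] [r3 i3]] := Linfty3_integrable LJ cJ.
have lin (g1 g2 g3 : R3 -> R) : (@leb3 R).-integrable setT (EFin \o g1) ->
    (@leb3 R).-integrable setT (EFin \o g2) ->
    (@leb3 R).-integrable setT (EFin \o g3) ->
    (@leb3 R).-integrable setT
      (EFin \o (fun y => m.1.1 * g1 y + m.1.2 * g2 y + m.2 * g3 y)).
  move=> h1 h2 h3.
  have := integrableD _ (integrableD _ (integrableZl _ m.1.1 h1)
    (integrableZl _ m.1.2 h2)) (integrableZl _ m.2 h3).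
  by apply.
split; [apply: eq_integrable (lin _ _ _ r1 r2 r3)|
  apply: eq_integrable (lin _ _ _ i1 i2 i3)] => // y _ /=; congr EFin;
  by rewrite /dotRC3; case: (J y) => [[[? ?] [? ?]] [? ?]] /=;
    rewrite !(mul0r, subr0, addr0).
Qed.

Lemma measurable_cosM k : measurable_fun [set: R] (fun a : R => cos (k * a)).
Proof.
have mcos : measurable_fun [set: R] (@cos R).
  by apply: continuous_measurable_fun; exact: continuous_cos.
by apply: (measurableT_comp mcos); exact: mulrl_measurable.
Qed.

Lemma measurable_sinM k : measurable_fun [set: R] (fun a : R => sin (k * a)).
Proof.
have msin : measurable_fun [set: R] (@sin R).
  by apply: continuous_measurable_fun; exact: continuous_sin.
by apply: (measurableT_comp msin); exact: mulrl_measurable.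
Qed.

Lemma far_fieldE J k : Linfty3 J -> compact (esupp J) ->
  let W1 := plane_integral (fun y => complex.Re (dotRC3 m (J y))) in
  let W2 := plane_integral (fun y => complex.Im (dotRC3 m (J y))) in
  dotRC3 m (cint3v (fun y => sclC3 (expi (- (k * dotR3 x0 y))) (J y))) =
  Complex (\int[leb]_a (cos (k * a) * W1 a - sin (k * a) * W2 a))
          (\int[leb]_a (sin (k * a) * W1 a + cos (k * a) * W2 a)).
Proof.
move=> LJ cJ W1 W2.
pose c y := cos (k * - dotR3 x0 y); pose s y := sin (k * - dotR3 x0 y).
have mc : measurable_fun setT c.
  exact: (measurableT_comp (measurable_cosM k) measurable_depth).
have ms : measurable_fun setT s.
  exact: (measurableT_comp (measurable_sinM k) measurable_depth).
have cg f : (@leb3 R).-integrable setT (EFin \o f) ->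
    (@leb3 R).-integrable setT (EFin \o (fun y => c y * f y)).
  by move=> fi; apply: (integrable_bounded_mul (M := 1)) => // y _; exact: cos_max.
have sg f : (@leb3 R).-integrable setT (EFin \o f) ->
    (@leb3 R).-integrable setT (EFin \o (fun y => s y * f y)).
  by move=> fi; apply: (integrable_bounded_mul (M := 1)) => // y _; exact: sin_max.
have e1 y (z : C) : complex.Re (expi (- (k * dotR3 x0 y)) * z) =
    c y * complex.Re z - s y * complex.Im z.
  by case: z => z1 z2; rewrite /expi /c /s mulrN.
have e2 y (z : C) : complex.Im (expi (- (k * dotR3 x0 y)) * z) =
    c y * complex.Im z + s y * complex.Re z.
  by case: z => z1 z2; rewrite /expi /c /s mulrN.
have eRe (z : R3 -> C) :
    (@leb3 R).-integrable setT (EFin \o (fun y => complex.Re (z y))) ->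
    (@leb3 R).-integrable setT (EFin \o (fun y => complex.Im (z y))) ->
    (@leb3 R).-integrable setT
      (fun y => (complex.Re (expi (- (k * dotR3 x0 y)) * z y))%:E).
  move=> zr zi; apply: eq_integrable (integrableB _ (cg _ zr) (sg _ zi)) => // y _ /=.
  by rewrite e1 EFinB.
have eIm (z : R3 -> C) :
    (@leb3 R).-integrable setT (EFin \o (fun y => complex.Re (z y))) ->
    (@leb3 R).-integrable setT (EFin \o (fun y => complex.Im (z y))) ->
    (@leb3 R).-integrable setT
      (fun y => (complex.Im (expi (- (k * dotR3 x0 y)) * z y))%:E).
  move=> zr zi; apply: eq_integrable (integrableD _ (cg _ zi) (sg _ zr)) => // y _ /=.
  by rewrite e2 EFinD.
have [[r1 i1] [r2 i2] [r3 i3]] := Linfty3_integrable LJ cJ.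
rewrite dotRC3_cint3v; last by split; split; rewrite /sclC3 /=;
  [exact: eRe|exact: eIm|exact: eRe|exact: eIm|exact: eRe|exact: eIm].
have dE y : dotRC3 m (sclC3 (expi (- (k * dotR3 x0 y))) (J y)) =
    expi (- (k * dotR3 x0 y)) * dotRC3 m (J y).
  by rewrite /dotRC3 /sclC3 /=; ring.
have [fr fi] := integrable_dotRC3 LJ cJ.
have [Wr Wi] := (integrable_plane_integral fr, integrable_plane_integral fi).
have cW g : leb.-integrable setT (EFin \o g) ->
    leb.-integrable setT (EFin \o (fun a => cos (k * a) * g a)).
  move=> gi; apply: (integrable_bounded_mul (M := 1)) => // [|a _].
    exact: measurable_cosM.
  exact: cos_max.
have sW g : leb.-integrable setT (EFin \o g) ->
    leb.-integrable setT (EFin \o (fun a => sin (k * a) * g a)).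
  move=> gi; apply: (integrable_bounded_mul (M := 1)) => // [|a _].
    exact: measurable_sinM.
  exact: sin_max.
rewrite /cint3; congr Complex.
  rewrite (RintegralB _ (cW _ Wr) (sW _ Wi))//.
  rewrite -(Rintegral_depth fr (measurable_cosM k) (fun a => cos_max _)).
  rewrite -(Rintegral_depth fi (measurable_sinM k) (fun a => sin_max _)).
  rewrite -(RintegralB _ (cg _ fr) (sg _ fi))//.
  by apply: eq_Rintegral => y _; rewrite dE e1.
rewrite (RintegralD _ (sW _ Wr) (cW _ Wi))//.
rewrite -(Rintegral_depth fr (measurable_sinM k) (fun a => sin_max _)).
rewrite -(Rintegral_depth fi (measurable_cosM k) (fun a => cos_max _)).
rewrite -(RintegralD _ (sg _ fr) (cg _ fi))//.
by apply: eq_Rintegral => y _; rewrite dE e2 addrC.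
Qed.

Lemma Jhat_eq0_ae J (S : set R) : Linfty3 J -> compact (esupp J) ->
  measurable S -> (forall y, S (- dotR3 x0 y) -> ~ esupp J y) ->
  {ae leb, forall a, S a -> Jhat x0 l m J a = 0}.
Proof.
move=> LJ cJ mS SJ; have [fr fi] := integrable_dotRC3 LJ cJ.
have J0 : {ae @leb3 R, forall y, S (- dotR3 x0 y) -> dotRC3 m (J y) = 0}.
  apply: filterS (ae_off_esupp J) => y h /SJ/h ->.
  by rewrite /dotRC3 /= !mulr0 !addr0.
have hr : {ae leb, forall a, S a ->
    plane_integral (fun y => complex.Re (dotRC3 m (J y))) a = 0}.
  by apply: plane_integral_eq0_ae => //; apply: filterS J0 => y h /h ->.
have hi : {ae leb, forall a, S a ->
    plane_integral (fun y => complex.Im (dotRC3 m (J y))) a = 0}.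
  by apply: plane_integral_eq0_ae => //; apply: filterS J0 => y h /h ->.
by apply: filterS2 hr hi => a ar ai Sa; rewrite JhatE ar// ai.
Qed.

Lemma dot_bounded (D : set R3) : compact D ->
  exists B : R, forall y, D y -> `|dotR3 x0 y| < B.
Proof.
move=> /compact_coords_bounded[M hM].
exists (`|x0.1.1| * M + `|x0.1.2| * M + `|x0.2| * M + 1) => y /hM[h1 h2 h3].
rewrite (@le_lt_trans _ _ (`|x0.1.1| * M + `|x0.1.2| * M + `|x0.2| * M))//; last first.
  by rewrite ltrDl.
rewrite /dotR3 (le_trans (ler_normD _ _))// lerD//.
  by rewrite (le_trans (ler_normD _ _))// !normrM lerD// ler_wpM2l.
by rewrite normrM ler_wpM2l.
Qed.

Lemma Rintegral_ae_support (D : set R) (g : R -> R) : measurable D ->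
  leb.-integrable setT (EFin \o g) ->
  {ae leb, forall a, ~ D a -> g a = 0} ->
  \int[leb]_(a in D) g a = \int[leb]_a g a.
Proof.
move=> mD gi g0; rewrite Rintegral_mkcond /Rintegral; congr fine.
have mg : measurable_fun setT g by apply/measurable_EFinP; exact: measurable_int gi.
apply: ae_eq_integral => //.
- apply/measurable_EFinP; apply/(measurable_restrictT _ _).1 => //.
  exact: measurable_funTS.
- exact/measurable_EFinP.
apply: filterS g0 => a ga _; rewrite patchE.
by case: (boolP (a \in D)) => // /negP aD; rewrite ga// => Da; apply: aD; rewrite inE.
Qed.

Lemma Jhat_ae_unique J1 J2 (kmin kmax : R) :
  Linfty3 J1 -> compact (esupp J1) -> Linfty3 J2 -> compact (esupp J2) ->
  kmin < kmax ->
  (forall k, kmin < k < kmax ->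
    dotRC3 m (cint3v (fun y => sclC3 (expi (- (k * dotR3 x0 y))) (J1 y))) =
    dotRC3 m (cint3v (fun y => sclC3 (expi (- (k * dotR3 x0 y))) (J2 y)))) ->
  {ae leb, forall a, Jhat x0 l m J1 a = Jhat x0 l m J2 a}.
Proof.
move=> L1 c1 L2 c2 K0 data.
have [B1 hB1] := dot_bounded c1; have [B2 hB2] := dot_bounded c2.
(* Both supports lie strictly between depths -B and B. [S] below is the full complement of that open
   interval, endpoints included, since [fourier_eq0_ae] is silent there. *)
pose B := Num.max B1 B2.
pose S : set R := [set a | B <= `|a|].
have mS : measurable S.
  rewrite (_ : S = `]-oo, - B] `|` `[B, +oo[); first exact: measurableU.
  apply/seteqP; split => a; rewrite /S /= !in_itv/= andbT ler_normr.
    by move=> /orP[|?]; [right|left; rewrite lerNr].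
  by move=> [h|->//]; apply/orP; right; rewrite lerNr.
have S1 : {ae leb, forall a, S a -> Jhat x0 l m J1 a = 0}.
  apply: Jhat_eq0_ae => // y; rewrite /S /= normrN => h /hB1 /lt_le_trans-/(_ B).
  by rewrite ltNge h le_max lexx => /(_ isT).
have S2 : {ae leb, forall a, S a -> Jhat x0 l m J2 a = 0}.
  apply: Jhat_eq0_ae => // y; rewrite /S /= normrN => h /hB2 /lt_le_trans-/(_ B).
  by rewrite ltNge h le_max lexx orbT => /(_ isT).
have [fr1 fi1] := integrable_dotRC3 L1 c1; have [fr2 fi2] := integrable_dotRC3 L2 c2.
pose W1 := plane_integral (fun y => complex.Re (dotRC3 m (J1 y))).
pose V1 := plane_integral (fun y => complex.Im (dotRC3 m (J1 y))).
pose W2 := plane_integral (fun y => complex.Re (dotRC3 m (J2 y))).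
pose V2 := plane_integral (fun y => complex.Im (dotRC3 m (J2 y))).
pose h1 a := W1 a - W2 a; pose h2 a := V1 a - V2 a.
have iW1 : leb.-integrable setT (EFin \o W1) := integrable_plane_integral fr1.
have iW2 : leb.-integrable setT (EFin \o W2) := integrable_plane_integral fr2.
have iV1 : leb.-integrable setT (EFin \o V1) := integrable_plane_integral fi1.
have iV2 : leb.-integrable setT (EFin \o V2) := integrable_plane_integral fi2.
have ih1 : leb.-integrable setT (EFin \o h1) by exact: (integrableB _ iW1 iW2).
have ih2 : leb.-integrable setT (EFin \o h2) by exact: (integrableB _ iV1 iV2).
have hS : {ae leb, forall a, S a -> h1 a = 0 /\ h2 a = 0}.
  apply: filterS2 S1 S2 => a s1 s2 Sa; move: (s1 Sa) (s2 Sa); rewrite !JhatE.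
  by rewrite /h1 /h2 /W1 /W2 /V1 /V2 => -[-> ->] [-> ->]; rewrite subrr.
have cW k g : leb.-integrable setT (EFin \o g) ->
    leb.-integrable setT (EFin \o (fun a => cos (k * a) * g a)).
  move=> gi; apply: (integrable_bounded_mul (M := 1)) => // [|a _].
    exact: measurable_cosM.
  exact: cos_max.
have sW k g : leb.-integrable setT (EFin \o g) ->
    leb.-integrable setT (EFin \o (fun a => sin (k * a) * g a)).
  move=> gi; apply: (integrable_bounded_mul (M := 1)) => // [|a _].
    exact: measurable_sinM.
  exact: sin_max.
have iR k (f g : R -> R) : leb.-integrable setT (EFin \o f) ->
    leb.-integrable setT (EFin \o g) -> leb.-integrable setT
      (EFin \o (fun a => cos (k * a) * f a - sin (k * a) * g a)).
  by move=> fi gi; exact: (integrableB _ (cW k _ fi) (sW k _ gi)).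
have iI k (f g : R -> R) : leb.-integrable setT (EFin \o f) ->
    leb.-integrable setT (EFin \o g) -> leb.-integrable setT
      (EFin \o (fun a => sin (k * a) * f a + cos (k * a) * g a)).
  by move=> fi gi; exact: (integrableD _ (sW k _ fi) (cW k _ gi)).
have ff k : kmin < k < kmax ->
    \int[leb]_a (cos (k * a) * W1 a - sin (k * a) * V1 a) =
    \int[leb]_a (cos (k * a) * W2 a - sin (k * a) * V2 a) /\
    \int[leb]_a (sin (k * a) * W1 a + cos (k * a) * V1 a) =
    \int[leb]_a (sin (k * a) * W2 a + cos (k * a) * V2 a).
  have inj (a b c d : R) : Complex a b = Complex c d -> a = c /\ b = d by case.
  move=> Kk; apply: inj.
  exact: (etrans (esym (far_fieldE k L1 c1))
    (etrans (data k Kk) (far_fieldE k L2 c2))).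
have dR k : kmin < k < kmax ->
    \int[leb]_a (cos (k * a) * h1 a - sin (k * a) * h2 a) = 0.
  move=> /ff[e _].
  transitivity (\int[leb]_a ((cos (k * a) * W1 a - sin (k * a) * V1 a) -
                             (cos (k * a) * W2 a - sin (k * a) * V2 a))).
    by apply: eq_Rintegral => a _; rewrite /h1 /h2; ring.
  by rewrite (RintegralB measurableT (iR k _ _ iW1 iV1) (iR k _ _ iW2 iV2)) e subrr.
have dI k : kmin < k < kmax ->
    \int[leb]_a (sin (k * a) * h1 a + cos (k * a) * h2 a) = 0.
  move=> /ff[_ e].
  transitivity (\int[leb]_a ((sin (k * a) * W1 a + cos (k * a) * V1 a) -
                             (sin (k * a) * W2 a + cos (k * a) * V2 a))).
    by apply: eq_Rintegral => a _; rewrite /h1 /h2; ring.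
  by rewrite (RintegralB measurableT (iI k _ _ iW1 iV1) (iI k _ _ iW2 iV2)) e subrr.
have mD : measurable (`[- B, B]%classic : set R) by exact: measurable_itv.
have phase0 p k : kmin < k < kmax ->
    \int[leb]_(a in `[- B, B]) phase_moment h1 h2 0 p k a = 0.
  move=> Kk.
  (* A phase [p] multiplies the integrand by e^{ip}, so its real part is a combination of the
     integrands of [dR] and [dI]. *)
  have pE a : phase_moment h1 h2 0 p k a =
      cos p * (cos (k * a) * h1 a - sin (k * a) * h2 a) -
      sin p * (sin (k * a) * h1 a + cos (k * a) * h2 a).
    by rewrite /phase_moment expr0 mul1r cosD sinD; ring.
  have i1 : leb.-integrable setT (EFin \o (fun a =>
      cos p * (cos (k * a) * h1 a - sin (k * a) * h2 a))).
    exact: (integrableZl _ _ (iR k _ _ ih1 ih2)).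
  have i2 : leb.-integrable setT (EFin \o (fun a =>
      sin p * (sin (k * a) * h1 a + cos (k * a) * h2 a))).
    exact: (integrableZl _ _ (iI k _ _ ih1 ih2)).
  rewrite Rintegral_ae_support//.
  - under eq_Rintegral do rewrite pE.
    rewrite (RintegralB _ i1 i2)// (RintegralZl _ _ (iR k _ _ ih1 ih2))//.
    by rewrite (RintegralZl _ _ (iI k _ _ ih1 ih2))// dR// dI// !mulr0 subrr.
  - by apply: eq_integrable (integrableB _ i1 i2) => // a _ /=; rewrite pE EFinB.
  - apply: filterS hS => a ha; rewrite /= in_itv/= -ler_norml => /negP.
    rewrite -ltNge => /ltW /ha[z1 z2].
    by rewrite /phase_moment z1 z2 !mulr0 subrr mulr0.
have ihD1 : leb.-integrable `[- B, B] (EFin \o h1) by exact: integrableS ih1.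
have ihD2 : leb.-integrable `[- B, B] (EFin \o h2) by exact: integrableS ih2.
have := fourier_eq0_ae ihD1 ihD2 phase0 K0.
move=> F; apply: filterS2 hS F => a ha1 ha2.
have [z1 z2] : h1 a = 0 /\ h2 a = 0.
  have [/ha1//|] := leP B `|a|.
  by rewrite ltr_norml => /ha2.
by rewrite !JhatE; congr Complex; apply/eqP; rewrite -subr_eq0; apply/eqP.
Qed.

Lemma negligible_depth (N : set R) : leb.-negligible N ->
  (@leb3 R).-negligible [set y | N (- dotR3 x0 y)].
Proof.
move=> [A [mA A0 NA]].
have mT : measurable ((fun y => - dotR3 x0 y) @^-1` A).
  by rewrite -[X in measurable X]setTI; exact: measurable_depth.
exists ((fun y => - dotR3 x0 y) @^-1` A); split => //; last by move=> y /NA.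
rewrite -plane_coords_preserving.2//.
have -> : plane_coords @^-1` ((fun y => - dotR3 x0 y) @^-1` A) = setT `*` A.
  by apply/seteqP; split => z /=; rewrite dot_plane_coords// => -[].
(* In plane coordinates the slab is the whole plane times [A]; infinity times 0 is 0. *)
transitivity (@leb2 R setT * leb A)%E; last by rewrite A0 mule0.
exact: (product_measure1E (@leb2 R) leb).
Qed.

(** [strip] is the preimage of this set under y.x0. Its elements are values of y.x0, the opposite of
    the plane parameter [alpha], whence the sign changes below. *)
Definition depth_range J : set R :=
  [set t | (ereal_inf [set (dotR3 z x0)%:E | z in esupp J] <= t%:E)%E /\
           (t%:E <= ereal_sup [set (dotR3 z x0)%:E | z in esupp J])%E].

(** The complement is used as a test set in [esupp], which must be open. Infinite bounds do occur:
    an empty support has infimum +oo and supremum -oo. *)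
Lemma closed_depth_range J : closed (depth_range J).
Proof.
rewrite /depth_range; set i := ereal_inf _; set s := ereal_sup _.
apply: (@closedI _ [set t : R | (i <= t%:E)%E] [set t : R | (t%:E <= s)%E]).
- case: i => [r| |].
  + by under eq_set do rewrite lee_fin; exact: closed_ge.
  + rewrite (_ : [set _ | _] = set0); first exact: closed0.
    by apply/seteqP; split => t//=; rewrite leye_eq.
  + rewrite (_ : [set _ | _] = setT); first exact: closedT.
    by apply/seteqP; split => t//= _; rewrite leNye.
- case: s => [r| |].
  + by under eq_set do rewrite lee_fin; exact: closed_le.
  + rewrite (_ : [set _ | _] = setT); first exact: closedT.
    by apply/seteqP; split => t//= _; rewrite leey.
  + rewrite (_ : [set _ | _] = set0); first exact: closed0.
    by apply/seteqP; split => t//=; rewrite leeNy_eq.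
Qed.

Lemma esupp_depth_range J y : esupp J y -> depth_range J (dotR3 y x0).
Proof.
by move=> yJ; split; [apply: ereal_inf_lbound|apply: ereal_sup_ubound]; exists y.
Qed.

Lemma dotR3C (y z : R3) : dotR3 y z = dotR3 z y.
Proof. by rewrite /dotR3; ring. Qed.

Lemma continuous_dot : continuous (fun y : R3 => dotR3 y x0).
Proof.
move=> y; rewrite /dotR3.
have c1 : (fun z : R3 => z.1.1) z @[z --> y] --> y.1.1.
  by apply: (cvg_comp (@fst (R * R)%type R) (@fst R R)); exact: cvg_fst.
have c2 : (fun z : R3 => z.1.2) z @[z --> y] --> y.1.2.
  by apply: (cvg_comp (@fst (R * R)%type R) (@snd R R));
    [exact: cvg_fst|exact: cvg_snd].
have c3 : (fun z : R3 => z.2) z @[z --> y] --> y.2 by exact: cvg_snd.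
by apply: cvgD; [apply: cvgD|]; apply: cvgMl.
Qed.

(* Off the depth range of J1 the plane integrals of J1, hence those of J2,
   vanish; by the hypothesis on J2 the part of its depth range lying there is
   null, so J2 itself vanishes there. *)
Lemma esupp_sub_depth_range J1 J2 :
  Linfty3 J1 -> compact (esupp J1) -> jhat_cond x0 l m J2 ->
  {ae leb, forall a, Jhat x0 l m J1 a = Jhat x0 l m J2 a} ->
  forall z, esupp J2 z -> depth_range J1 (dotR3 z x0).
Proof.
move=> L1 c1 cond2 J12 z zJ; apply: contrapT => nz.
pose S : set R := -%R @^-1` (~` depth_range J1).
have mS : measurable S.
  rewrite /S -[X in measurable X]setTI; apply: oppr_measurable => //.
  by apply: measurableC; apply: closed_measurable; exact: closed_depth_range.
have S0 : {ae leb, forall a, S a -> Jhat x0 l m J1 a = 0}.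
  apply: Jhat_eq0_ae => // y; rewrite /S /= opprK dotR3C => h /esupp_depth_range.
  exact: h.
have N0 : leb.-negligible (S `&` (-%R @^-1` depth_range J2)).
  have := negligibleU (negligibleU cond2 J12) S0.
  apply: negligibleS => a [Sa ra].
  (* Off the two exceptional null sets, [Jhat] of [J2] is 0 at [a]; the plane at [a] also lies in
     the strip of [J2], so [a] belongs to the set that [cond2] makes null. *)
  have [s0|] := pselect (S a -> Jhat x0 l m J1 a = 0); last by right.
  left; have [e|] := pselect (Jhat x0 l m J1 a = Jhat x0 l m J2 a); last by right.
  left; split; last by rewrite -e s0.
  by move=> y /eqP; rewrite addr_eq0 => /eqP ya; rewrite /strip /= ya.
(* Membership of [z] in the support is refuted on this open set: a point of it where [J2] is nonzero
   is off [esupp J2] or has its depth in the null set [N0]. *)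
apply: (zJ [set y | ~ depth_range J1 (dotR3 y x0)]) => //.
  apply: (open_comp (f := fun y : R3 => dotR3 y x0) (D := ~` depth_range J1)).
    by move=> y _; exact: continuous_dot.
  by apply: closed_openC; exact: closed_depth_range.
apply: negligibleS (negligibleU (negligible_off_esupp J2) (negligible_depth N0)).
move=> y [ny Jy]; have [yJ|] := pselect (esupp J2 y); last by left.
by right; rewrite /S /= opprK dotR3C; split => //; exact: esupp_depth_range.
Qed.

Lemma strip_subset J1 J2 :
  (forall z, esupp J2 z -> depth_range J1 (dotR3 z x0)) ->
  strip x0 J2 `<=` strip x0 J1.
Proof.
move=> h y [h1 h2]; split; [apply: le_trans h1|apply: (le_trans h2)].
  by apply: le_ereal_inf_tmp => _ [z /h[z1 _] <-].
by apply: ge_ereal_sup => _ [z /h[_ z2] <-].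
Qed.

End FarField.

(** * Vector algebra of the measured component *)

Section FarFieldAlgebra.
Variable R : realType.
Local Notation R3 := (R * R * R)%type.
Local Notation C := (complex R).
Implicit Types (u v x m l : R3) (J : R3 -> C * C * C).

Lemma dotR3_ge0 u : 0 <= dotR3 u u.
Proof. by rewrite /dotR3 !addr_ge0// -expr2 sqr_ge0. Qed.

Lemma dotR3_eq0 u : dotR3 u u = 0 -> u = (0, 0, 0).
Proof.
case: u => [[a b] c]; rewrite /dotR3 /= -!expr2 => /eqP.
rewrite !paddr_eq0 ?addr_ge0 ?sqr_ge0// !sqrf_eq0.
by move=> /andP[/andP[/eqP-> /eqP->] /eqP->].
Qed.

Lemma sphere2P u : sphere2 u -> dotR3 u u = 1.
Proof.
by rewrite /sphere2 /normR3 /= => h; rewrite -(sqr_sqrtr (dotR3_ge0 u)) h expr1n.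
Qed.

Lemma dotR3_normalize u : u != (0, 0, 0) ->
  dotR3 (sclR3 (normR3 u)^-1 u) (sclR3 (normR3 u)^-1 u) = 1.
Proof.
move=> u0; have d0 : dotR3 u u != 0 by apply: contra_neq u0 => /dotR3_eq0.
transitivity ((normR3 u ^+ 2)^-1 * dotR3 u u).
  by rewrite -exprVn /dotR3 /sclR3 /=; ring.
by rewrite /normR3 sqr_sqrtr ?dotR3_ge0// mulVf.
Qed.

Lemma lagrange_identity u v :
  dotR3 (crossR3 u v) (crossR3 u v) = dotR3 u u * dotR3 v v - dotR3 u v ^+ 2.
Proof. by rewrite /dotR3 /crossR3 /=; ring. Qed.

(** [m] is a unit vector orthogonal to [x], so the tangential projection leaves the [m]-component
    alone, and the dipole polarized along [l] radiates exactly along [m]. Hence [tau] enters with a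
    factor of modulus |k|. *)
Lemma dotRC3_Einf_z0 (eps mu k : R) (z0 x l : R3) J (tau : C) :
  let m := crossR3 x l in dotR3 x x = 1 -> dotR3 l l = 1 -> dotR3 l x = 0 ->
  dotRC3 m (Einf_z0 eps mu k z0 x J tau l) =
  'i * (k / Num.sqrt (eps * mu) * mu)%:C *
    dotRC3 m (cint3v (fun y => sclC3 (expi (- (k * dotR3 x y))) (J y))) +
  'i * k%:C * expi (- (k * dotR3 x z0)) * tau.
Proof.
move=> m xx ll lx.
have mx : dotR3 m x = 0 by rewrite /m /dotR3 /crossR3 /=; ring.
have mm : dotR3 m m = 1.
  have xl : dotR3 x l = 0 by rewrite -[RHS]lx /dotR3; ring.
  by rewrite /m lagrange_identity xx ll xl mulr1 expr0n subr0.
have mxC : (m.1.1)%:C * (x.1.1)%:C + (m.1.2)%:C * (x.1.2)%:C + (m.2)%:C * (x.2)%:C = 0.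
  by rewrite -!rmorphM -!rmorphD -[RHS](rmorph0 (real_complex R)) -mx.
have mmC : (m.1.1)%:C * (m.1.1)%:C + (m.1.2)%:C * (m.1.2)%:C + (m.2)%:C * (m.2)%:C = 1.
  by rewrite -!rmorphM -!rmorphD -[RHS](rmorph1 (real_complex R)) -mm.
have expand (p : R3) (w : C * C * C) (a b : C) :
    dotRC3 p (addC3 (sclC3 a (tproj x w)) (sclCR3 b p)) =
    a * (dotRC3 p w - dotRC3 x w *
      ((p.1.1)%:C * (x.1.1)%:C + (p.1.2)%:C * (x.1.2)%:C + (p.2)%:C * (x.2)%:C)) +
    b * ((p.1.1)%:C * (p.1.1)%:C + (p.1.2)%:C * (p.1.2)%:C + (p.2)%:C * (p.2)%:C).
  by rewrite /dotRC3 /addC3 /sclC3 /tproj /sclCR3 /addC3 /dotRC3 /=; ring.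
rewrite /Einf_z0 /Einf expand mxC mmC mulr0 subr0 mulr1.
by congr (_ + _); rewrite mulrAC.
Qed.

Lemma expi_neq0 (t : R) : expi t != 0.
Proof.
rewrite /expi eq_complex /=; apply/negP => /andP[/eqP c0 /eqP s0].
by have := cos2Dsin2 t; rewrite c0 s0 !expr0n addr0 => /eqP; rewrite eq_sym oner_eq0.
Qed.

End FarFieldAlgebra.

Unset Implicit Arguments.

Theorem theorem4p2 (R : realType) (eps mu kmin kmax : R) (z0 xh0 q0 : R * R * R)
    (tau1 tau2 tau3 : complex R) (J1 J2 : R * R * R -> complex R * complex R * complex R) :
  0 < eps -> 0 < mu -> 0 < kmin -> kmin < kmax ->
  tau1 != tau2 -> tau1 != tau3 -> tau2 != tau3 ->
  (forall a b : R, a%:C * (tau2 - tau1) + b%:C * (tau3 - tau1) = 0 -> a = 0 /\ b = 0) ->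
  sphere2 xh0 -> sphere2 q0 -> crossR3 xh0 q0 != (0, 0, 0) ->
  let l := sclR3 (normR3 (crossR3 xh0 q0))^-1 (crossR3 xh0 q0) in
  let m := crossR3 xh0 l in
  Linfty3 J1 -> compact (esupp J1) -> jhat_cond xh0 l m J1 ->
  Linfty3 J2 -> compact (esupp J2) -> jhat_cond xh0 l m J2 ->
  (forall k : R, kmin < k < kmax ->
     forall tau : complex R, tau = tau1 \/ tau = tau2 \/ tau = tau3 ->
     `|dotRC3 m (Einf_z0 eps mu k z0 xh0 J1 tau l)|
       = `|dotRC3 m (Einf_z0 eps mu k z0 xh0 J2 tau l)|) ->
  strip xh0 J1 = strip xh0 J2.
Proof.
move=> eps0 mu0 kmin0 kK _ _ _ ind Sx _ cross0 l m L1 c1 cond1 L2 c2 cond2 data.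
have xx := sphere2P Sx.
have ll : dotR3 l l = 1 by exact: dotR3_normalize.
have lx : dotR3 l xh0 = 0.
  by rewrite /l; move: (_^-1) => n; rewrite /dotR3 /sclR3 /crossR3 /=; ring.
have mx : dotR3 m xh0 = 0 by rewrite /m /dotR3 /crossR3 /=; ring.
have det1 : detR3 l m xh0 = 1.
  (* The triple product equals |m|^2, which Lagrange's identity expands. *)
  transitivity (dotR3 xh0 xh0 * dotR3 l l - dotR3 l xh0 ^+ 2).
    by rewrite /m /detR3 /dotR3 /crossR3 /=; ring.
  by rewrite xx ll lx; ring.
have ff k : kmin < k < kmax ->
    dotRC3 m (cint3v (fun y => sclC3 (expi (- (k * dotR3 xh0 y))) (J1 y))) =
    dotRC3 m (cint3v (fun y => sclC3 (expi (- (k * dotR3 xh0 y))) (J2 y))).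
  move=> Kk; have k0 : 0 < k by case/andP: Kk => /(lt_trans kmin0).
  have a0 : 'i * (k / Num.sqrt (eps * mu) * mu)%:C != 0 :> complex R.
    rewrite mulf_neq0 ?neq0Ci// (inj_eq (@complexI R) _ 0).
    by rewrite gt_eqF// mulr_gt0// divr_gt0// sqrtr_gt0 mulr_gt0.
  have b0 : 'i * k%:C * expi (- (k * dotR3 xh0 z0)) != 0 :> complex R.
    rewrite !mulf_neq0 ?neq0Ci ?expi_neq0// (inj_eq (@complexI R) _ 0).
    by rewrite gt_eqF.
  (* Phase retrieval is applied to the [m]-components including their prefactor; the factor of [tau]
     is nonzero because [k] is positive, and the common prefactor is then cancelled. *)
  apply: (mulfI a0); apply: (phase_retrieval ind b0);
    rewrite -!dotRC3_Einf_z0//; apply: data => //; tauto.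
have J12 := Jhat_ae_unique xx lx mx det1 L1 c1 L2 c2 kK ff.
have J21 := Jhat_ae_unique xx lx mx det1 L2 c2 L1 c1 kK (fun k h => esym (ff k h)).
(* Each inclusion uses the measure-zero condition of the source whose strip is to be contained in
   the other. *)
apply/seteqP; split; apply: strip_subset.
  exact: (esupp_sub_depth_range xx lx mx det1 L2 c2 cond1 J21).
exact: (esupp_sub_depth_range xx lx mx det1 L1 c1 cond2 J12).
Qed.
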